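(* Let $\xi\in\mathbb C$. For every $\tau\in\mathbb C$, the $\mathfrak{sl}_2$-module $X(\xi)$ has a filtration $$X(\xi)\supseteq(c-\tau)X(\xi)\supseteq(c-\tau)^2X(\xi)\supseteq\cdots$$ with corresponding subquotients isomorphic to $\overline X(\xi,\tau)=X(\xi)/(c-\tau)X(\xi)$. (i) If $\tau-(\xi+2j+1)^2\neq0$ for all $j\in\mathbb Z_{\ge0}$, then $\overline X(\xi,\tau)\cong\mathbf V(\overline\xi,\tau)$. (ii) If $\tau-(\xi+2j_0+1)^2=0$ for some minimal $j_0\in\mathbb Z_{\ge0}$, then there is a proper submodule $Y(\xi,\tau)\subseteq\overline X(\xi,\tau)$ such that $$\overline X(\xi,\tau)/Y(\xi,\tau)\cong M(\xi+2j_0);\qquad Y(\xi,\tau)\cong V(\xi+2j_0+2).$$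
   Context: $\mathfrak{sl}_2=\mathfrak{sl}_2(\mathbb C)$ has basis $e,h,f$ with $[h,e]=2e$, $[e,f]=h$, $[h,f]=-2f$. $c=4ef+(h-1)^2=4fe+(h+1)^2\in U(\mathfrak{sl}_2)$ is the Casimir element, which is central. For $\xi\in\mathbb C$, $X(\xi)=U(\mathfrak{sl}_2)\otimes_{U(\mathbb Ch)}\mathbb C_\xi$, where $h$ acts on $\mathbb C_\xi=\mathbb C$ by $\xi$. $M(\delta)$ is the highest weight Verma module of highest weight $\delta$, and $V(\delta)$ is the lowest weight Verma module of lowest weight $\delta$. For $\xi,\tau\in\mathbb C$ and $\overline\xi=\xi+2\mathbb Z$, $\mathbf V(\overline\xi,\tau)$ is the $\mathfrak{sl}_2$-module with basis $\{v_\eta\mid\eta\in\xi+2\mathbb Z\}$ and action $fv_\eta=v_{\eta-2}$, $hv_\eta=\eta v_\eta$, $ev_\eta=\frac14(\tau-(\eta+1)^2)v_{\eta+2}$. *)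

(* Defs.v *)
From HB Require Import structures.
From mathcomp Require Import all_boot all_order all_algebra.
From mathcomp Require Import finmap.
From mathcomp Require Import boolp reals.
From mathcomp Require Import complex ring.
From mathcomp.multinomials Require Import monalg.

Set Implicit Arguments.
Unset Strict Implicit.
Unset Printing Implicit Defensive.

Import GRing.Theory Num.Theory.
Local Open Scope ring_scope.
Local Open Scope quotient_scope.

Section Submodules.
Variables (R : pzRingType) (V : lmodType R).

Inductive in_span (P : V -> Prop) : V -> Prop :=
| in_span0 : in_span P 0
| in_spanD a x y : P x -> in_span P y -> in_span P (a *: x + y).

Definition span (P : V -> Prop) : {pred V} := fun x => `[< in_span P x >].

Lemma span_closed P : subsemimod_closed (span P).
Proof.
split; first split.
- by apply/asboolP; exact: in_span0.
- move=> x y /asboolP hx /asboolP hy; apply/asboolP.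
  elim: hx => [|a u v Pu _ IH]; first by rewrite add0r.
  by rewrite -addrA; exact: in_spanD.
- move=> a x /asboolP hx; apply/asboolP.
  elim: hx => [|b u v Pu _ IH]; first by rewrite scaler0; exact: in_span0.
  by rewrite scalerDr scalerA; exact: in_spanD.
Qed.
HB.instance Definition _ P :=
  GRing.isSubSemiModClosed.Build R V (span P) (span_closed P).

Definition submod_type (S : submodClosed V) := {x : V | x \in S}.

End Submodules.

HB.instance Definition _ (R : pzRingType) (V : lmodType R)
  (S : submodClosed V) := SubChoice.on (submod_type S).
HB.instance Definition _ (R : pzRingType) (V : lmodType R)
  (S : submodClosed V) := [SubChoice_isSubLmodule of submod_type S by <:].

Section ModuleQuotient.
Variables (R : pzRingType) (V : lmodType R) (S : submodClosed V).

Definition zmod_of_submod : {pred V} := fun x => x \in S.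

Lemma zmod_of_submod_closed : zmod_closed zmod_of_submod.
Proof.

by split=> [|x y Sx Sy]; [exact: rpred0 | apply: rpredD; rewrite // -scaleN1r rpredZ].
Qed.
HB.instance Definition _ :=
  GRing.isZmodClosed.Build V zmod_of_submod zmod_of_submod_closed.

Definition quotmod := Quotient.quot zmod_of_submod.
HB.instance Definition _ := GRing.Zmodule.on quotmod.

Definition qcl (x : V) : quotmod := \pi_(Quotient.quot zmod_of_submod) x.

Lemma qcl_surj q : {x | q = qcl x}.
Proof. by exists (repr q); rewrite /qcl reprK. Qed.

Lemma qclP x y : reflect (qcl x = qcl y) (x - y \in S).
Proof. by rewrite -[_ \in S]/(_ \in zmod_of_submod) Quotient.idealrBE; exact: eqP. Qed.

Lemma qcl0 : qcl 0 = 0. Proof. exact: raddf0. Qed.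
Lemma qclD : {morph qcl : x y / x + y}. Proof. exact: raddfD. Qed.

Definition qscale : R -> quotmod -> quotmod := locked (fun a q =>
  qcl (a *: repr (q : Quotient.quot zmod_of_submod))).

Lemma qscaleE a x : qscale a (qcl x) = qcl (a *: x).
Proof.
rewrite /qscale -lock; apply/qclP; rewrite -scalerBr; apply: rpredZ; apply/qclP.
by rewrite /qcl reprK.
Qed.

Lemma qscaleA a b q : qscale a (qscale b q) = qscale (a * b) q.
Proof. by have [x ->] := qcl_surj q; rewrite !qscaleE scalerA. Qed.
Lemma qscale1 : left_id 1 qscale.
Proof. by move=> q; have [x ->] := qcl_surj q; rewrite qscaleE scale1r. Qed.
Lemma qscaleDr : right_distributive qscale +%R.
Proof.
move=> a p q; have [x ->] := qcl_surj p; have [y ->] := qcl_surj q.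
by rewrite -qclD !qscaleE scalerDr qclD.
Qed.
Lemma qscaleDl q : {morph qscale^~ q : a b / a + b}.
Proof.
by move=> a b; have [x ->] := qcl_surj q; rewrite !qscaleE scalerDl qclD.
Qed.
HB.instance Definition _ := GRing.Zmodule_isLmodule.Build R quotmod
  qscaleA qscale1 qscaleDr qscaleDl.

Lemma qcl_linear : linear qcl.
Proof. by move=> a x y; rewrite qclD -qscaleE. Qed.
HB.instance Definition _ := GRing.isLinear.Build R V quotmod _ qcl qcl_linear.

End ModuleQuotient.

Section AlgebraQuotient.
Variables (K : fieldType) (A : algType K) (P : A -> Prop).

Inductive in_ideal : A -> Prop :=
| in_ideal0 : in_ideal 0
| in_idealD a r b x : P r -> in_ideal x -> in_ideal (a * r * b + x).

Definition ideal : {pred A} := fun x => `[< in_ideal x >].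

Lemma in_ideal_sum x y : in_ideal x -> in_ideal y -> in_ideal (x + y).
Proof.
elim=> [|a r b u Pr _ IH] hy; first by rewrite add0r.
by rewrite -addrA; apply: in_idealD => //; exact: IH.
Qed.

Lemma in_idealM a b x : in_ideal x -> in_ideal (a * x * b).
Proof.
elim=> [|c r d u Pr _ IH]; first by rewrite mulr0 mul0r; exact: in_ideal0.
by rewrite mulrDr mulrDl !mulrA -mulrA; exact: in_idealD.
Qed.

Lemma ideal_closed : subsemimod_closed ideal.
Proof.
split; first split.
- by apply/asboolP; exact: in_ideal0.
- by move=> x y /asboolP hx /asboolP hy; apply/asboolP; exact: in_ideal_sum.
- move=> a x /asboolP hx; apply/asboolP.
  by rewrite -[x]mul1r -[_ * _]mulr1 !scalerAl; exact: in_idealM.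
Qed.
HB.instance Definition _ :=
  GRing.isSubSemiModClosed.Build K A ideal ideal_closed.

Definition quotalg := quotmod ideal.
HB.instance Definition _ := GRing.Lmodule.on quotalg.

Definition alg_pi (x : A) : quotalg := qcl ideal x.
Lemma alg_pi_linear : linear alg_pi.
Proof. exact: qcl_linear. Qed.
HB.instance Definition _ :=
  GRing.isLinear.Build K A quotalg _ alg_pi alg_pi_linear.

Lemma alg_piD x y : alg_pi (x + y) = alg_pi x + alg_pi y.
Proof. exact: linearD. Qed.
Lemma alg_piN x : alg_pi (- x) = - alg_pi x.
Proof. exact: linearN. Qed.
Lemma alg_piZ a x : alg_pi (a *: x) = a *: alg_pi x.
Proof. exact: linearZ_LR. Qed.

Lemma alg_pi_surj q : {x | q = alg_pi x}.
Proof. exact: qcl_surj. Qed.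

Lemma alg_piP x y : reflect (alg_pi x = alg_pi y) (x - y \in ideal).
Proof. exact: qclP. Qed.

Definition qmul : quotalg -> quotalg -> quotalg := locked (fun p q =>
  alg_pi (projT1 (alg_pi_surj p) * projT1 (alg_pi_surj q))).

Lemma qmulE x y : qmul (alg_pi x) (alg_pi y) = alg_pi (x * y).
Proof.
rewrite /qmul -lock; case: alg_pi_surj => x' /= /alg_piP/asboolP hx.
case: alg_pi_surj => y' /= /alg_piP/asboolP hy; apply/esym/alg_piP/asboolP.
have -> : x * y - x' * y' = 1 * (x - x') * y + x' * (y - y') * 1.
  by rewrite mul1r mulr1 mulrBl mulrBr addrA subrK.
by apply: in_ideal_sum; exact: in_idealM.
Qed.

Lemma qmulA : associative qmul.
Proof.
move=> p q r; have [x ->] := alg_pi_surj p; have [y ->] := alg_pi_surj q.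
by have [z ->] := alg_pi_surj r; rewrite !qmulE mulrA.
Qed.
Lemma qmul1 : left_id (alg_pi 1) qmul.
Proof. by move=> p; have [x ->] := alg_pi_surj p; rewrite qmulE mul1r. Qed.
Lemma qmulr1 : right_id (alg_pi 1) qmul.
Proof. by move=> p; have [x ->] := alg_pi_surj p; rewrite qmulE mulr1. Qed.
Lemma qmulDl : left_distributive qmul +%R.
Proof.
move=> p q r; have [x ->] := alg_pi_surj p; have [y ->] := alg_pi_surj q.
by have [z ->] := alg_pi_surj r; rewrite -linearD !qmulE mulrDl linearD.
Qed.
Lemma qmulDr : right_distributive qmul +%R.
Proof.
move=> p q r; have [x ->] := alg_pi_surj p; have [y ->] := alg_pi_surj q.
by have [z ->] := alg_pi_surj r; rewrite -linearD !qmulE mulrDr linearD.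
Qed.
HB.instance Definition _ := GRing.Zmodule_isPzRing.Build quotalg
  qmulA qmul1 qmulr1 qmulDl qmulDr.

Lemma alg_piM x y : alg_pi (x * y) = alg_pi x * alg_pi y.
Proof. exact/esym/qmulE. Qed.
HB.instance Definition _ := GRing.isMonoidMorphism.Build A quotalg alg_pi
  (erefl, alg_piM).

Lemma qscalerAl (a : K) (p q : quotalg) : a *: (p * q) = (a *: p) * q.
Proof.
have [x ->] := alg_pi_surj p; have [y ->] := alg_pi_surj q.
by rewrite -[in RHS]linearZ -!rmorphM -linearZ scalerAl.
Qed.
Lemma qscalerAr (a : K) (p q : quotalg) : a *: (p * q) = p * (a *: q).
Proof.
have [x ->] := alg_pi_surj p; have [y ->] := alg_pi_surj q.
by rewrite -[in RHS]linearZ -!rmorphM -linearZ scalerAr.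
Qed.

End AlgebraQuotient.

Section LinearExtension.
Variables (R : nzRingType) (T : choiceType) (M : lmodType R) (w : T -> M).

Definition linext (x : {malg R[T]}) : M := \sum_(k <- msupp x) x@_k *: w k.

Lemma linextEw (d : {fset T}) x : (msupp x `<=` d)%fset ->
  linext x = \sum_(k <- d) x@_k *: w k.
Proof.
move=> le; rewrite /linext [LHS](big_fset_incl _ le) //= => k _.
by move=> /mcoeff_outdom ->; rewrite scale0r.
Qed.

Lemma linextU c k : linext (mkmalgU k c) = c *: w k.
Proof. by rewrite (linextEw msuppU_le) big_seq_fset1 mcoeffUU. Qed.

Lemma linext_linear : linear linext.
Proof.
move=> a x y; have [lx ly] := (fsubsetUl (msupp x) (msupp y),
  fsubsetUr (msupp x) (msupp y)).
have lD := fsubset_trans (msuppD_le (a *: x) y)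
  (fsetSU (msupp y) (msuppZ_le a x)).
rewrite (linextEw lD) (linextEw lx) (linextEw ly) scaler_sumr -big_split /=.
by apply: eq_bigr => k _; rewrite mcoeffD mcoeffZ scalerDl scalerA.
Qed.
HB.instance Definition _ :=
  GRing.isLinear.Build R {malg R[T]} M _ linext linext_linear.

Lemma malg_linear_eq (f g : {linear {malg R[T]} -> M}) :
  (forall k, f (mkmalgU k 1) = g (mkmalgU k 1)) -> f =1 g.
Proof.
move=> fg x; rewrite [x]monalgE !linear_sum; apply: eq_bigr => k _.
have -> : mkmalgU k x@_k = x@_k *: mkmalgU k 1 :> {malg R[T]}.
  by apply/malgP => l; rewrite mcoeffZ !mcoeffU mulr_natr.
by rewrite !linearZ fg.
Qed.

End LinearExtension.

Definition falg (K : fieldType) (I : choiceType) := {malg K[{fmonom I}]}.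
HB.instance Definition _ (K : fieldType) (I : choiceType) :=
  GRing.Lalgebra.on (falg K I).

Section FreeAlgebra.
Variables (K : fieldType) (I : choiceType).

Lemma falg_scalerAr (a : K) (x y : falg K I) : a *: (x * y) = x * (a *: y).
Proof.
apply/malgP => m; rewrite mcoeffZ.
rewrite (mcoeffMlw m (fsubset_refl (msupp x)) (fsubset_refl (msupp y))).
rewrite (mcoeffMlw m (fsubset_refl (msupp x)) (msuppZ_le a y)).
rewrite mulr_sumr; apply: eq_bigr => i _.
rewrite mulr_sumr; apply: eq_bigr => j _.
by rewrite mcoeffZ mulrnAr mulrCA.
Qed.
HB.instance Definition _ := GRing.Lalgebra_isAlgebra.Build K (falg K I)
  falg_scalerAr.

Definition fword (m : {fmonom I}) : falg K I := mkmalgU m 1.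
Definition fvar (i : I) : falg K I := fword (fmu i).

Section Action.
Variables (V : lmodType K) (g : I -> {linear V -> V}).

(* [act x v] is the value at v of the noncommutative polynomial x in the     *)
(* operators [g i]: the word i1 ... in acts as g i1 \o ... \o g in.          *)
Definition act (x : falg K I) (v : V) : V :=
  linext (fun m : {fmonom I} => foldr g v m) x.

Lemma actU c m v : act (mkmalgU m c) v = c *: foldr g v m.
Proof. exact: linextU. Qed.

Lemma act_linearl v : linear (act^~ v).
Proof. exact: linext_linear. Qed.

Lemma foldrD (m : seq I) : {morph (fun v => foldr g v m) : u v / u + v}.
Proof. by move=> u v; elim: m => //= i m ->; rewrite linearD. Qed.

Lemma foldr0 (m : seq I) : foldr g 0 m = 0.
Proof. by elim: m => //= i m ->; rewrite linear0. Qed.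

Lemma foldrZ (m : seq I) a v : foldr g (a *: v) m = a *: foldr g v m.
Proof. by elim: m => //= i m ->; rewrite linearZ. Qed.

Lemma act_linear x : linear (act x).
Proof.
move=> a u v; rewrite /act /linext scaler_sumr -big_split /=.
by apply: eq_bigr => m _; rewrite foldrD foldrZ scalerDr !scalerA mulrC.
Qed.
HB.instance Definition _ x :=
  GRing.isLinear.Build K V V _ (act x) (act_linear x).

Lemma actD x y v : act (x + y) v = act x v + act y v.
Proof. exact: (linearD (linext (fun m : {fmonom I} => foldr g v m))). Qed.

Lemma actN x v : act (- x) v = - act x v.
Proof. exact: (linearN (linext (fun m : {fmonom I} => foldr g v m))). Qed.

Lemma actZ c x v : act (c *: x) v = c *: act x v.
Proof. exact: (linearZ_LR (linext (fun m : {fmonom I} => foldr g v m))). Qed.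

Lemma act0 v : act 0 v = 0.
Proof. exact: (linear0 (linext (fun m : {fmonom I} => foldr g v m))). Qed.

Lemma act1 v : act 1 v = v.
Proof. by rewrite actU fm1 scale1r. Qed.

Lemma actM x y v : act (x * y) v = act x (act y v).
Proof.
rewrite malgME (big_morph (act^~ v) (fun x y => actD x y v) (act0 v)).
rewrite [RHS]/act /linext; apply: eq_bigr => i _.
rewrite (big_morph (act^~ v) (fun x y => actD x y v) (act0 v)).
rewrite (big_morph (fun u => foldr g u i) (foldrD i) (foldr0 i)) scaler_sumr.
by apply: eq_bigr => j _; rewrite actU fmM foldr_cat foldrZ scalerA.
Qed.

Lemma act_fvar i v : act (fvar i) v = g i v.
Proof. by rewrite actU fmU scale1r. Qed.

End Action.
End FreeAlgebra.

Section PresentedAlgebra.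
Variables (K : fieldType) (I : choiceType) (rels : seq (falg K I)).

Definition palg := quotalg (fun r : falg K I => r \in rels).
HB.instance Definition _ := GRing.PzRing.on palg.
HB.instance Definition _ := GRing.Lmodule.on palg.

Definition pvar (i : I) : palg := alg_pi _ (fvar K i).

Record rep := Rep {
  rep_sort :> lmodType K;
  rep_op : I -> {linear rep_sort -> rep_sort};
  rep_rels : forall r, r \in rels -> forall v, act rep_op r v = 0
}.

(* A representation of the presented algebra, seen as a module over it. *)
Definition repmod (M : rep) : Type := rep_sort M.
HB.instance Definition _ M := GRing.Zmodule.on (repmod M).

Section RepModule.
Variable M : rep.

Lemma act_ideal x v : x \in ideal (fun r : falg K I => r \in rels) ->
  act (@rep_op M) x v = 0.
Proof.
move/asboolP; elim=> [|a r b y rP _ IH]; first exact: act0.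
by rewrite actD IH !actM (rep_rels rP) linear0 addr0.
Qed.

Definition rep_scale : palg -> repmod M -> repmod M := locked (fun u v =>
  act (@rep_op M) (projT1 (alg_pi_surj u)) v).

Lemma rep_scaleE x v : rep_scale (alg_pi _ x) v = act (@rep_op M) x v.
Proof.
rewrite /rep_scale -lock; case: alg_pi_surj => y /= /alg_piP xy.
have := act_ideal v xy.
by rewrite actD actN => /eqP; rewrite subr_eq0 => /eqP.
Qed.

Lemma rep_scaleA p q v :
  rep_scale p (rep_scale q v) = rep_scale (p * q) v.
Proof.
have [x ->] := alg_pi_surj p; have [y ->] := alg_pi_surj q.
by rewrite -alg_piM !rep_scaleE actM.
Qed.
Lemma rep_scale1 : left_id 1 rep_scale.
Proof. by move=> v; rewrite rep_scaleE act1. Qed.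
Lemma rep_scaleDr : right_distributive rep_scale +%R.
Proof.
move=> p u v; have [x ->] := alg_pi_surj p.
by rewrite !rep_scaleE linearD.
Qed.
Lemma rep_scaleDl v : {morph rep_scale^~ v : p q / p + q}.
Proof.
move=> p q; have [x ->] := alg_pi_surj p; have [y ->] := alg_pi_surj q.
by rewrite -linearD !rep_scaleE actD.
Qed.
HB.instance Definition _ := GRing.Zmodule_isLmodule.Build palg (repmod M)
  rep_scaleA rep_scale1 rep_scaleDr rep_scaleDl.

Lemma pvar_scale i (v : repmod M) : pvar i *: v = @rep_op M i v.
Proof. by rewrite [LHS]rep_scaleE act_fvar. Qed.

End RepModule.
End PresentedAlgebra.

Section Lift.
Variables (K : fieldType) (I : choiceType) (B : algType K) (b : I -> B).

Definition lmulop (u : B) (x : B) : B := u * x.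
Lemma lmulop_linear u : linear (lmulop u).
Proof. by move=> a x y; rewrite /lmulop mulrDr scalerAr. Qed.
HB.instance Definition _ u :=
  GRing.isLinear.Build K B B _ (lmulop u) (lmulop_linear u).

Definition evalnc (x : falg K I) : B := act (fun i => lmulop (b i)) x 1.

Lemma act_lmulop x v : act (fun i => lmulop (b i)) x v = evalnc x * v.
Proof.
rewrite /evalnc /act /linext mulr_suml; apply: eq_bigr => m _.
rewrite -scalerAl; congr (_ *: _).
by elim: (fmonom_val m) => [|i s IH] /=; rewrite ?mul1r // IH /lmulop mulrA.
Qed.

Lemma evalncM x y : evalnc (x * y) = evalnc x * evalnc y.
Proof. by rewrite {1}/evalnc actM act_lmulop. Qed.
Lemma evalnc1 : evalnc 1 = 1. Proof. exact: act1. Qed.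
Lemma evalncD x y : evalnc (x + y) = evalnc x + evalnc y.
Proof. exact: actD. Qed.
Lemma evalncN x : evalnc (- x) = - evalnc x. Proof. exact: actN. Qed.
Lemma evalncZ a x : evalnc (a *: x) = a *: evalnc x. Proof. exact: actZ. Qed.
Lemma evalnc_var i : evalnc (fvar K i) = b i.
Proof. by rewrite /evalnc act_fvar /= /lmulop mulr1. Qed.
Definition evalncE := (evalncM, evalncD, evalncN, evalncZ, evalnc_var).

Variable rels : seq (falg K I).
Hypothesis b_rels : forall r, r \in rels -> evalnc r = 0.

Definition plift_fun (u : palg rels) : B := evalnc (projT1 (alg_pi_surj u)).

Lemma pliftE x : plift_fun (alg_pi _ x) = evalnc x.
Proof.
rewrite /plift_fun; case: alg_pi_surj => y /= /alg_piP/asboolP xy.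
suff /eqP : evalnc (x - y) = 0.
  by rewrite evalncD evalncN subr_eq0 => /eqP.
elim: xy => [|a r c z rP _ IH]; first exact: act0.
by rewrite evalncD IH !evalncM (b_rels rP) mulr0 mul0r addr0.
Qed.

Lemma plift_is_zmod_morphism : zmod_morphism plift_fun.
Proof.
move=> p q; have [x ->] := alg_pi_surj p; have [y ->] := alg_pi_surj q.
by rewrite -linearB !pliftE evalncD evalncN.
Qed.

Lemma plift_is_monoid_morphism : monoid_morphism plift_fun.
Proof.
split=> [|p q]; first by rewrite pliftE evalnc1.
have [x ->] := alg_pi_surj p; have [y ->] := alg_pi_surj q.
by rewrite -alg_piM !pliftE evalncM.
Qed.
Definition plift : {rmorphism palg rels -> B} :=
  HB.pack_for {rmorphism palg rels -> B} plift_fun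
    (GRing.isZmodMorphism.Build _ _ plift_fun plift_is_zmod_morphism)
    (GRing.isMonoidMorphism.Build _ _ plift_fun plift_is_monoid_morphism).

Lemma plift_var i : plift (pvar rels i) = b i.
Proof. by rewrite [LHS]pliftE evalnc_var. Qed.

End Lift.

(* U (x)_A N along phi : A -> U, as the free left U-module on the symbols     *)
(* 1 (x) n modulo additivity in n and u phi(a) (x) n = u (x) a n.             *)
Section TensorProduct.
Variables (A : pzRingType) (U : nzRingType) (phi : {rmorphism A -> U}).
Variable N : lmodType A.

Definition tsym (u : U) (n : N) : {malg U[N]} := mkmalgU n u.

Inductive tensor_rel : {malg U[N]} -> Prop :=
| tensor_relD u n n' :
    tensor_rel (tsym u (n + n') - tsym u n - tsym u n')
| tensor_relZ u a n :
    tensor_rel (tsym (u * phi a) n - tsym u (a *: n)).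

Definition tensor := quotmod (span tensor_rel).
HB.instance Definition _ := GRing.Lmodule.on tensor.

Definition tpure (u : U) (n : N) : tensor := qcl _ (tsym u n).

End TensorProduct.

Section Subquotient.
Variables (R : pzRingType) (V : lmodType R) (B A : submodClosed V).

Definition submod_in : {pred submod_type B} := fun x => val x \in A.

Lemma submod_in_closed : subsemimod_closed submod_in.
Proof.
split; first split.
- by rewrite [_ \in _]rpred0.
- by move=> x y hx hy; rewrite [_ \in _]rpredD.
- by move=> a x hx; rewrite [_ \in _]rpredZ.
Qed.
HB.instance Definition _ := GRing.isSubSemiModClosed.Build R (submod_type B)
  submod_in submod_in_closed.

Definition subquot := quotmod submod_in.
HB.instance Definition _ := GRing.Lmodule.on subquot.

End Subquotient.

Definition isomorphic (R : pzRingType) (V W : lmodType R) : Prop :=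
  exists f : {linear V -> W}, bijective f.

Inductive sl2_gen := Ge | Gh | Gf.
Definition sl2_gen_code (x : sl2_gen) : option bool :=
  match x with Ge => Some true | Gf => Some false | Gh => None end.
Definition sl2_gen_decode (x : option bool) : sl2_gen :=
  match x with Some true => Ge | Some false => Gf | None => Gh end.
Lemma sl2_gen_codeK : cancel sl2_gen_code sl2_gen_decode.
Proof. by case. Qed.
HB.instance Definition _ := Choice.copy sl2_gen (can_type sl2_gen_codeK).

Section CasimirIdentities.
Variables (R : pzRingType) (e h f : R).
Hypothesis he : h * e - e * h = e *+ 2.
Hypothesis ef : e * f - f * e = h.
Hypothesis hf : h * f - f * h = - (f *+ 2).

Lemma sl2_heE : h * e = e * h + e *+ 2.
Proof. by rewrite -he addrC subrK. Qed.
Lemma sl2_hfE : h * f = f * h - f *+ 2.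
Proof. by rewrite -hf addrC subrK. Qed.
Lemma sl2_efE : e * f = f * e + h.
Proof. by rewrite -ef addrC subrK. Qed.
Lemma sl2_h1e : (h - 1) * e = e * (h + 1).
Proof. by rewrite mulrBl mulrDr sl2_heE mul1r mulr1 mulr2n -!addrA subrr addr0. Qed.
Lemma sl2_h1f : (h + 1) * f = f * (h - 1).
Proof.
by rewrite mulrDl mulrBr sl2_hfE mul1r mulr1 mulr2n opprD -!addrA addNr addr0.
Qed.

Lemma sl2_casimirE :
  4%:R * e * f + (h - 1) ^+ 2 = 4%:R * f * e + (h + 1) ^+ 2.
Proof.
rewrite -!mulrA !mulr_natl sl2_efE mulrnDl -addrA; congr (_ + _).
rewrite addrC sqrrB1 sqrrD1 addrAC; congr (_ + _); rewrite -addrA.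
by congr (_ + _); rewrite addrC -mulrnBr.
Qed.

Lemma sl2_casimir_e : (4%:R * e * f + (h - 1) ^+ 2) * e
                    = e * (4%:R * e * f + (h - 1) ^+ 2).
Proof.
rewrite [in RHS]sl2_casimirE mulrDl mulrDr -!mulrA !mulr_natl mulrnAr.
by congr (_ + _); rewrite !expr2 sl2_h1e mulrA sl2_h1e mulrA.
Qed.

Lemma sl2_casimir_f : (4%:R * e * f + (h - 1) ^+ 2) * f
                    = f * (4%:R * e * f + (h - 1) ^+ 2).
Proof.
rewrite [in LHS]sl2_casimirE mulrDl mulrDr -!mulrA !mulr_natl mulrnAr.
by congr (_ + _); rewrite !expr2 sl2_h1f mulrA sl2_h1f mulrA.
Qed.

Lemma sl2_casimir_h : (4%:R * e * f + (h - 1) ^+ 2) * h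
                    = h * (4%:R * e * f + (h - 1) ^+ 2).
Proof.
rewrite mulrDl mulrDr -!mulrA !mulr_natl mulrnAr; congr (_ *+ _ + _).
  rewrite [RHS]mulrA sl2_heE mulrDl -[e * h * f]mulrA sl2_hfE mulrBr.
  by rewrite mulrnAl mulrnAr subrK.
have hc : GRing.comm h ((h - 1) ^+ 2).
  exact/commrX/commrB/commr1/commr_refl.
by rewrite -[RHS]/(h * (h - 1) ^+ 2) hc expr2 mulrA.
Qed.
End CasimirIdentities.

Section EnvelopingAlgebra.
Variable K : numFieldType.

Local Notation "''E'" := (fvar K Ge).
Local Notation "''H'" := (fvar K Gh).
Local Notation "''F'" := (fvar K Gf).

Definition sl2_rels : seq (falg K sl2_gen) :=
  [:: 'H * 'E - 'E * 'H - 2%:R *: 'E;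
      'E * 'F - 'F * 'E - 'H;
      'H * 'F - 'F * 'H + 2%:R *: 'F].

Definition usl2 := palg sl2_rels.
HB.instance Definition _ := GRing.PzRing.on usl2.
HB.instance Definition _ := GRing.Lmodule.on usl2.

Definition usl2_gen (i : sl2_gen) : usl2 := pvar sl2_rels i.
Definition sl2_e : usl2 := usl2_gen Ge.
Definition sl2_h : usl2 := usl2_gen Gh.
Definition sl2_f : usl2 := usl2_gen Gf.

Lemma usl2_one_neq0 : (1 : usl2) != 0.
Proof.
have K0 r : r \in sl2_rels ->
    forall v : K^o, act (fun=> \0 : {linear K^o -> K^o}) r v = 0.
  rewrite !inE => /or3P[] /eqP-> v;
    by rewrite !(actD, actN, actZ, actM, act_fvar) /= ?scaler0 !(subr0, addr0).
pose M := Rep K0.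
apply/eqP => U10; have := scale1r (1 : repmod M).
rewrite [1 in LHS]U10.
rewrite scale0r => /eqP; rewrite eq_sym.
exact/negP/oner_neq0.
Qed.
HB.instance Definition _ := GRing.PzSemiRing_isNonZero.Build usl2 usl2_one_neq0.
HB.instance Definition _ := GRing.LSemiModule_isLSemiAlgebra.Build K usl2
  (@qscalerAl K (falg K sl2_gen) (fun r => r \in sl2_rels)).
HB.instance Definition _ := GRing.Lalgebra_isAlgebra.Build K usl2
  (@qscalerAr K (falg K sl2_gen) (fun r => r \in sl2_rels)).

Lemma usl2_rel r : r \in sl2_rels ->
  alg_pi (fun r => r \in sl2_rels) r = 0 :> usl2.
Proof.
move=> rP; rewrite -(linear0 (alg_pi (fun r => r \in sl2_rels))).
apply/alg_piP/asboolP; rewrite subr0.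
by have := @in_idealD _ _ (fun r => r \in sl2_rels) 1 r 1 0 rP (in_ideal0 _);
   rewrite mul1r mulr1 addr0.
Qed.

Lemma usl2_he : sl2_h * sl2_e - sl2_e * sl2_h = 2%:R *: sl2_e.
Proof.
have := usl2_rel (mem_nth 0 (isT : 0 < size sl2_rels)%N).
rewrite /nth /sl2_rels !(alg_piD, alg_piN, alg_piZ, alg_piM) => rel0.
by apply/eqP; rewrite -subr_eq0; apply/eqP; exact: rel0.
Qed.
Lemma usl2_ef : sl2_e * sl2_f - sl2_f * sl2_e = sl2_h.
Proof.
have := usl2_rel (mem_nth 0 (isT : 1 < size sl2_rels)%N).
rewrite /nth /sl2_rels !(alg_piD, alg_piN, alg_piZ, alg_piM) => rel0.
by apply/eqP; rewrite -subr_eq0; apply/eqP; exact: rel0.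
Qed.
Lemma usl2_hf : sl2_h * sl2_f - sl2_f * sl2_h = - (2%:R *: sl2_f).
Proof.
have := usl2_rel (mem_nth 0 (isT : 2 < size sl2_rels)%N).
rewrite /nth /sl2_rels !(alg_piD, alg_piN, alg_piZ, alg_piM) => rel0.
by apply/eqP; rewrite -addr_eq0; apply/eqP; exact: rel0.
Qed.

Lemma usl2_ind (P : usl2 -> Prop) :
  P 1 -> (forall a u v, P u -> P v -> P (a *: u + v)) ->
  (forall i u, P u -> P (usl2_gen i * u)) -> forall u, P u.
Proof.
move=> P1 PD PM u; have [x ->] := alg_pi_surj u.
have P0 : P 0 by have := PD (-1) 1 1 P1 P1; rewrite scaleN1r addNr.
rewrite [x]monalgE linear_sum /=; elim: (enum_fset _) => [|m s IH].
  by rewrite big_nil.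
rewrite big_cons.
have -> : mkmalgU m x@_m = x@_m *: fword K m.
  by apply/malgP => l; rewrite mcoeffZ !mcoeffU mulr_natr.
rewrite alg_piZ; apply: PD IH.
case: m => m; elim: m => [|i m IH].
  suff -> : fword K (FMonom [::]) = 1 :> falg K sl2_gen by [].
  by congr (mkmalgU _ 1); apply/eqP; rewrite fmP fm1.
suff -> : fword K (FMonom (i :: m)) = fvar K i * fword K (FMonom m).
  by rewrite alg_piM; exact: PM.
rewrite /fvar /fword malgM_def fgmulUU mulr1; congr (mkmalgU _ 1).
by apply/eqP; rewrite fmP fmM fmU.
Qed.

Definition casimir : usl2 := 4%:R * sl2_e * sl2_f + (sl2_h - 1) ^+ 2.

Lemma casimir_e : casimir * sl2_e = sl2_e * casimir.
Proof.
exact: (sl2_casimir_e (etrans usl2_he (scaler_nat 2 sl2_e)) usl2_ef).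
Qed.
Lemma casimir_h : casimir * sl2_h = sl2_h * casimir.
Proof.
exact: (sl2_casimir_h (etrans usl2_he (scaler_nat 2 sl2_e))
  (etrans usl2_hf (congr1 -%R (scaler_nat 2 sl2_f)))).
Qed.
Lemma casimir_f : casimir * sl2_f = sl2_f * casimir.
Proof.
exact: (sl2_casimir_f usl2_ef (etrans usl2_hf (congr1 -%R (scaler_nat 2 sl2_f)))).
Qed.

Lemma casimir_central u : casimir * u = u * casimir.
Proof.
move: casimir casimir_e casimir_h casimir_f => c ce ch cf.
elim/usl2_ind: u => [|a u v IHu IHv|i u IH]; first by rewrite mulr1 mul1r.
  by rewrite mulrDr mulrDl -scalerAl -scalerAr IHu IHv.
have ci : c * usl2_gen i = usl2_gen i * c by case: i; [exact: ce | exact: ch | exact: cf].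
by rewrite mulrA ci -mulrA IH mulrA.
Qed.


Section CasimirImage.
Variables (tau : K) (k : nat) (V : lmodType usl2).

(* (c - tau)^k V *)
Definition cas_img : {pred V} :=
  fun y => `[< exists x : V, y = (casimir - tau%:A) ^+ k *: x >].

Lemma cas_img_closed : subsemimod_closed cas_img.
Proof.
have zC u : u * (casimir - tau%:A) ^+ k = (casimir - tau%:A) ^+ k * u.
  apply: commrX; apply: commrB; first exact/esym/casimir_central.
  by rewrite /GRing.comm mulr_algl mulr_algr.
split; first split.
- by apply/asboolP; exists 0; rewrite scaler0.
- move=> _ _ /asboolP[x ->] /asboolP[y ->]; apply/asboolP.
  by exists (x + y); rewrite scalerDr.
- move=> a _ /asboolP[x ->]; apply/asboolP; exists (a *: x).
  by rewrite !scalerA zC.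
Qed.
HB.instance Definition _ :=
  GRing.isSubSemiModClosed.Build usl2 V cas_img cas_img_closed.

End CasimirImage.
Arguments cas_img tau k V _ : clear implicits.

Definition homothety (a : K) (x : K^o) : K^o := a * x.
Lemma homothety_linear a : linear (homothety a).
Proof. by move=> b x y; rewrite /homothety mulrDr scalerAr. Qed.
HB.instance Definition _ a :=
  GRing.isLinear.Build K K^o K^o _ (homothety a) (homothety_linear a).

(* U(Ch) is presented by the single generator h and no relation. *)
Definition uh_rels : seq (falg K unit) := [::].

Lemma charh_rels (xi : K) r : r \in uh_rels ->
  forall v : K^o, act (fun _ : unit => homothety xi : {linear _ -> _}) r v = 0.
Proof. by []. Qed.
Definition charh (xi : K) : rep uh_rels := Rep (@charh_rels xi).

Lemma uh_to_usl2_rels r : r \in uh_rels -> evalnc (fun _ : unit => sl2_h) r = 0.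
Proof. by []. Qed.

Definition X (xi : K) :=
  tensor (plift uh_to_usl2_rels) (repmod (charh xi)).
HB.instance Definition _ xi := GRing.Lmodule.on (X xi).

Definition Xbar (xi tau : K) := quotmod (cas_img tau 1 (X xi)).
HB.instance Definition _ xi tau := GRing.Lmodule.on (Xbar xi tau).

(* The Borel subalgebras Ch + Ce (s = 2) and Ch + Cf (s = -2): [true] stands  *)
(* for h and [false] for the root vector.                                     *)
Definition borel_rels (s : K) : seq (falg K bool) :=
  [:: fvar K true * fvar K false - fvar K false * fvar K true
      - s *: fvar K false].

Definition charb_op (delta : K) (i : bool) : {linear K^o -> K^o} :=
  if i then homothety delta : {linear K^o -> K^o} else \0.

Lemma charb_rels (s delta : K) r : r \in borel_rels s ->
  forall v : K^o, act (charb_op delta) r v = 0.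
Proof.
rewrite mem_seq1 => /eqP-> v.
rewrite !(actD, actN, actZ, actM, act_fvar) /= /homothety.
by rewrite mulr0 scaler0 !subr0.
Qed.
Definition charb (s delta : K) : rep (borel_rels s) :=
  Rep (@charb_rels s delta).

Definition bplus_img (i : bool) : usl2 := if i then sl2_h else sl2_e.
Definition bminus_img (i : bool) : usl2 := if i then sl2_h else sl2_f.

Lemma bplus_to_usl2_rels r : r \in borel_rels 2%:R -> evalnc bplus_img r = 0.
Proof.
rewrite mem_seq1 => /eqP->; rewrite !evalncE /=.
by apply/eqP; rewrite subr_eq0; apply/eqP; exact: usl2_he.
Qed.
Lemma bminus_to_usl2_rels r :
  r \in borel_rels (- 2%:R) -> evalnc bminus_img r = 0.
Proof.
rewrite mem_seq1 => /eqP->; rewrite !evalncE /= scaleNr opprK.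
by apply/eqP; rewrite addr_eq0; apply/eqP; exact: usl2_hf.
Qed.

(* Verma modules U (x)_{U(b)} C_delta, of highest, resp. lowest, weight delta. *)
Definition VermaHigh (delta : K) :=
  tensor (plift bplus_to_usl2_rels) (repmod (charb 2%:R delta)).
HB.instance Definition _ delta := GRing.Lmodule.on (VermaHigh delta).

Definition VermaLow (delta : K) :=
  tensor (plift bminus_to_usl2_rels) (repmod (charb (- 2%:R) delta)).
HB.instance Definition _ delta := GRing.Lmodule.on (VermaLow delta).

Section WeightRelations.
Variables (V : lmodType K) (E H F : {linear V -> V}).

Lemma weight_he a c u v : H u = a *: u -> E u = c *: v ->
  H v = (a + 2%:R) *: v -> H (E u) - E (H u) - 2%:R *: E u = 0.
Proof.
move=> Hu Eu Hv; rewrite Hu Eu 2!linearZ_LR Hv Eu 3!scalerA -2!scalerBl.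
by rewrite -[RHS](scale0r v); congr (_ *: _); ring.
Qed.
Lemma weight_hf a u v : H u = a *: u -> F u = v ->
  H v = (a + (- 2)%:~R) *: v -> H (F u) - F (H u) + 2%:R *: F u = 0.
Proof.
move=> Hu Fu Hv; rewrite Hu Fu linearZ_LR Hv Fu -scalerBl -scalerDl.
by rewrite -[RHS](scale0r v); congr (_ *: _); ring.
Qed.
Lemma weight_ef a c d u v w : E u = c *: v -> F u = w -> E w = d *: u ->
  F v = u -> H u = a *: u -> d - c = a -> E (F u) - F (E u) - H u = 0.
Proof.
move=> Eu Fu Ew Fv Hu dc; rewrite Hu Fu Eu linearZ_LR Ew Fv -2!scalerBl.
by rewrite dc subrr scale0r.
Qed.
End WeightRelations.

Section DenseModule.
Variables (xi tau : K).

Definition coset := {eta : K | `[< exists k : int, eta = xi + (2 * k)%:~R >]}.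
HB.instance Definition _ := Choice.on coset.

Lemma coset_shift_subproof (k : int) (eta : coset) :
  `[< exists l : int, val eta + (2 * k)%:~R = xi + (2 * l)%:~R >].
Proof.
have /asboolP[l ->] := valP eta; apply/asboolP; exists (l + k).
by rewrite mulrDr rmorphD /= addrA.
Qed.
(* eta + 2k *)
Definition coset_shift (k : int) (eta : coset) : coset :=
  exist _ (val eta + (2 * k)%:~R) (coset_shift_subproof k eta).

Lemma coset_shiftD k l eta :
  coset_shift k (coset_shift l eta) = coset_shift (l + k) eta.
Proof. by apply: val_inj; rewrite /= mulrDr rmorphD /= addrA. Qed.
Lemma coset_shift0 eta : coset_shift 0 eta = eta.
Proof. by apply: val_inj; rewrite /= mulr0 addr0. Qed.

Definition wvec (eta : coset) : {malg K[coset]} := mkmalgU eta 1.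

Definition dense_op (i : sl2_gen) : {linear {malg K[coset]} -> {malg K[coset]}} :=
  match i with
  | Gf => linext (fun eta => wvec (coset_shift (- 1) eta))
  | Gh => linext (fun eta => val eta *: wvec eta)
  | Ge => linext (fun eta =>
            (4%:R^-1 * (tau - (val eta + 1) ^+ 2)) *: wvec (coset_shift 1 eta))
  end.

Lemma linext_wvec (w : coset -> {malg K[coset]}) eta :
  linext w (wvec eta) = w eta.
Proof. by rewrite linextU scale1r. Qed.

Lemma dense_eE eta : dense_op Ge (wvec eta)
  = (4%:R^-1 * (tau - (val eta + 1) ^+ 2)) *: wvec (coset_shift 1 eta).
Proof. exact: linext_wvec. Qed.
Lemma dense_hE eta : dense_op Gh (wvec eta) = val eta *: wvec eta.
Proof. exact: linext_wvec. Qed.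
Lemma dense_fE eta : dense_op Gf (wvec eta) = wvec (coset_shift (- 1) eta).
Proof. exact: linext_wvec. Qed.

Lemma dense_rels r : r \in sl2_rels -> forall v, act dense_op r v = 0.
Proof.
have n4 : 4%:R != 0 :> K by rewrite pnatr_eq0.
move=> rP; apply: (malg_linear_eq (f := act dense_op r) (g := \0)) => eta.
change (act dense_op r (wvec eta) = 0).
move: rP; rewrite !inE => /or3P[] /eqP->;
  rewrite !(actD, actN, actZ, actM, act_fvar).
- apply: (weight_he (dense_hE eta) (dense_eE eta)); rewrite dense_hE /=.
  by rewrite mulr1.
- apply: (weight_ef (dense_eE eta) (dense_fE eta) _ _ (dense_hE eta)).
  + by rewrite dense_eE coset_shiftD addNr coset_shift0.
  + by rewrite dense_fE coset_shiftD subrr coset_shift0.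
  + by rewrite /= mulrN1; field.
- apply: (weight_hf (dense_hE eta) (dense_fE eta)); rewrite dense_hE /=.
  by rewrite mulrN1.
Qed.

Definition dense_rep : rep sl2_rels := Rep dense_rels.

(* The weight module V(xi + 2Z, tau). *)
Definition dense := repmod dense_rep.
HB.instance Definition _ := GRing.Zmodule.on dense.
HB.instance Definition _ := GRing.Lmodule.copy dense (repmod dense_rep).

End DenseModule.

End EnvelopingAlgebra.

Arguments cas_img {K} tau k V _.

(* Main.v *)
Require Import Defs.
From HB Require Import structures.
From mathcomp Require Import all_boot all_order all_algebra.
From mathcomp Require Import boolp reals complex.
From mathcomp Require Import finmap functions ring.
From mathcomp.multinomials Require Import monalg.

(** All the modules involved are generated by a vector [v] of weight [xi], and
    are therefore spanned over [K[c]], [c] the Casimir element, by the chain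
    [v_j = e^j v] ([j >= 0]), [v_j = f^(-j) v] ([j < 0]), whose weights
    [xi + 2j] are pairwise distinct.  As weight vectors are independent, a
    homomorphism out of such a module is injective as soon as it is injective
    on each [K[c] v_j], so every isomorphism is checked on single chain vectors.
    The chain of [X(xi)] is free over [K[c]] because [X(xi)] maps, for every
    [tau], to a weight module on functions [int -> K] where [c] acts by [tau]
    and [v_j] goes to the indicator function of [j]; this gives the injectivity
    of [c - tau].  In case (ii), [Y] is generated by [e^(j0+1) v]. *)

Set Implicit Arguments.
Unset Strict Implicit.
Unset Printing Implicit Defensive.

Import Order.TTheory GRing.Theory Num.Theory.
Local Open Scope ring_scope.

(** * Quotients and subquotients *)

Section Isomorphisms.
Variable R : pzRingType.

Lemma isomorphic_sym (V W : lmodType R) : isomorphic V W -> isomorphic W V.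
Proof.
case=> f [g fK gK].
have g_lin : linear g.
  by move=> a x y; apply: (can_inj fK); rewrite linearP !gK.
pose gL := HB.pack_for {linear W -> V} g (GRing.isLinear.Build R W V _ g g_lin).
by exists gL; exists f.
Qed.

Lemma lin_iso (V W : lmodType R) (f : {linear V -> W}) :
  (forall x, f x = 0 -> x = 0) -> (forall y, exists x, y = f x) ->
  isomorphic V W.
Proof.
move=> kerf /choice[g gK]; exists f; exists g => // x.
by apply/eqP; rewrite -subr_eq0; apply/eqP/kerf; rewrite linearB -gK subrr.
Qed.

Section Factor.
Variables (V W : lmodType R) (S : submodClosed V) (g : {linear V -> W}).
Hypothesis gS : {in S, forall x, g x = 0}.

(** Evaluating [g] at a chosen representative is independent of the choice because [g] kills [S]. *)
Lemma quotmod_factor : exists f : {linear quotmod S -> W},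
  forall x, f (qcl S x) = g x.
Proof.
pose f (q : quotmod S) : W := g (projT1 (qcl_surj q)).
have fE x : f (qcl S x) = g x.
  rewrite /f; case: qcl_surj => y /= /qclP /gS.
  by rewrite linearB => /eqP; rewrite subr_eq0 => /eqP.
have f_lin : linear f.
  move=> a p q; have [x ->] := qcl_surj p; have [y ->] := qcl_surj q.
  by rewrite -linearP !fE linearP.
by exists (HB.pack_for {linear quotmod S -> W} f
  (GRing.isLinear.Build R (quotmod S) W _ f f_lin)).
Qed.

Lemma quotmod_iso : (forall x, g x = 0 -> x \in S) ->
  (forall y, exists x, y = g x) -> isomorphic (quotmod S) W.
Proof.
move=> kerg surjg; have [f fE] := quotmod_factor; apply: (lin_iso (f := f)).
  move=> q; have [x ->] := qcl_surj q; rewrite fE => /kerg xS.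
  by rewrite -qcl0; apply/qclP; rewrite subr0.
by move=> y; have [x ->] := surjg y; exists (qcl S x).
Qed.
End Factor.

(** The composite of [g : V -> B] with the projection to B/A is onto with kernel [S], the preimage
    of [A]. It is used with [g] a multiplication by a power of c - tau. *)
Lemma subquot_iso (V : lmodType R) (B A S : submodClosed V)
    (g : {linear V -> V}) :
  (forall x, g x \in B) -> {in B, forall y, exists x, y = g x} ->
  (forall x, (g x \in A) = (x \in S)) -> isomorphic (subquot B A) (quotmod S).
Proof.
move=> gB surj_g gA; apply: isomorphic_sym.
pose gsub x : submod_type B := Sub (g x) (gB x).
have gsub_lin : linear gsub by move=> a x y; apply: val_inj; rewrite /= linearP.
pose gL := HB.pack_for {linear V -> submod_type B} gsub
  (GRing.isLinear.Build R V (submod_type B) _ gsub gsub_lin).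
have in_A (q : submod_type B) : qcl (@submod_in R V B A) q = 0 <-> val q \in A.
  rewrite -(qcl0 (@submod_in R V B A)).
  by split=> [/qclP|qA]; last apply/qclP; rewrite subr0.
have gE x : val (gL x) = g x by [].
apply: (quotmod_iso (g := qcl (@submod_in R V B A) \o gL)) => [x xS|x|y].
- by apply/in_A; rewrite gE gA.
- by move/in_A; rewrite gE gA.
- have [q ->] := qcl_surj y; have [x gx] := surj_g _ (valP q).
  by exists x; congr qcl; apply: val_inj; rewrite gE.
Qed.

End Isomorphisms.

(** * Modules induced from a character *)

Lemma scale_mkmalgU (R : nzRingType) (T : choiceType) (a c : R) (k : T) :
  a *: mkmalgU k c = mkmalgU k (a * c).
Proof. by apply/malgP => l; rewrite mcoeffZ !mcoeffU mulrnAr. Qed.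

(** Every noncommutative polynomial is a linear combination of words, and words are built by
    prepending letters. *)
Lemma falg_ind (K : fieldType) (I : choiceType) (P : falg K I -> Prop) :
  P 1 -> (forall a x y, P x -> P y -> P (a *: x + y)) ->
  (forall i x, P x -> P (fvar K i * x)) -> forall x, P x.
Proof.
move=> P1 PD PM x.
have P0 : P 0 by have := PD (-1) 1 1 P1 P1; rewrite scaleN1r addNr.
rewrite [x]monalgE; elim: (enum_fset _) => [|m s IH]; first by rewrite big_nil.
rewrite big_cons.
have -> : mkmalgU m x@_m = x@_m *: fword K m.
  by rewrite scale_mkmalgU mulr1.
apply: PD IH; case: m => m; elim: m => [|i m IH].
  suff -> : fword K (FMonom [::]) = 1 :> falg K I by [].
  by congr (mkmalgU _ 1); apply/eqP; rewrite fmP fm1.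
suff -> : fword K (FMonom (i :: m)) = fvar K i * fword K (FMonom m) by exact: PM.
rewrite /fvar /fword malgM_def fgmulUU mulr1; congr (mkmalgU _ 1).
by apply/eqP; rewrite fmP fmM fmU.
Qed.

Section InducedCharacter.
Variables (K : fieldType) (I : choiceType) (B : algType K) (b : I -> B).
Variables (rels : seq (falg K I)) (op : I -> {linear K^o -> K^o}).
Hypothesis b_rels : forall r, r \in rels -> evalnc b r = 0.
Hypothesis op_rels : forall r, r \in rels -> forall v : K^o, act op r v = 0.

Local Notation M := (repmod (Rep op_rels)).
Local Notation T := (tensor (plift b_rels) M).

(** If the generators act on the multiples of [v] through the character, so does every
    noncommutative polynomial. The scalar [n] stays general because each letter changes it during
    the induction. *)
Lemma evalnc_act (V : lmodType B) (v : V) :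
  (forall i (n : K^o), b i *: (n%:A *: v) = (op i n)%:A *: v) ->
  forall x (n : K^o), evalnc b x *: (n%:A *: v) = (act op x n)%:A *: v.
Proof.
move=> bv; elim/falg_ind=> [|c x y IHx IHy|i x IH] n.
- by rewrite evalnc1 act1 scale1r.
- rewrite evalncD evalncZ actD actZ !scalerDl -IHy; congr (_ + _).
  by rewrite -[c *: evalnc b x]mulr_algl -scalerA IHx scalerA mulr_algl scalerA.
- by rewrite evalncM actM evalnc_var act_fvar -scalerA IH bv.
Qed.

Definition tgen : T := tpure (plift b_rels) 1 (1 : M).

Lemma tpureM u a (n : M) :
  tpure (plift b_rels) (u * plift b_rels a) n = tpure (plift b_rels) u (a *: n).
Proof.
apply/qclP/asboolP; rewrite -[_ - _]addr0 -[X in in_span _ (X + _)]scale1r.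
by apply: in_spanD; [exact: tensor_relZ | exact: in_span0].
Qed.

Lemma scale_tpure u u' (n : M) :
  u *: tpure (plift b_rels) u' n = tpure (plift b_rels) (u * u') n.
Proof.
rewrite /tpure -linearZ; congr (qcl _ _); exact: scale_mkmalgU.
Qed.

(** The generator moves across the tensor sign, acts there by the scalar [op i 1], and this scalar
    moves back. *)
Lemma pvar_tgen i : b i *: tgen = (op i 1)%:A *: tgen.
Proof.
(* Scalars of the presented algebra act on the one-dimensional module by multiplication in [K]. *)
have scaleM (c n : K) : alg_pi _ (c%:A) *: (n : M) = c * n :> K.
  by rewrite [LHS]rep_scaleE actZ act1.
rewrite !scale_tpure !mulr1.
rewrite -(plift_var b_rels) -[plift _ _]mul1r tpureM pvar_scale /=.
rewrite -[X in tpure _ _ X]mulr1 -[X in tpure _ _ X]scaleM.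
rewrite -tpureM mul1r; congr (tpure _ _ _).
by rewrite [LHS](pliftE b_rels); apply: (etrans (evalncZ b (op i 1) 1)); rewrite evalnc1.
Qed.

(** The second factor is one-dimensional, so a pure tensor of u and n is the multiple u n of
    [tgen]. *)
Lemma tgen_cyclic x : exists u, x = u *: tgen.
Proof.
have scaleM (c n : K) : alg_pi _ (c%:A) *: (n : M) = c * n :> K.
  by rewrite [LHS]rep_scaleE actZ act1.
have [y ->] := qcl_surj x; rewrite [y]monalgE linear_sum /=.
elim: (enum_fset _) => [|n s [u IH]]; first by exists 0; rewrite big_nil scale0r.
rewrite big_cons IH; set c := y@_n.
exists (c * plift b_rels (alg_pi _ (n : K)%:A) + u); rewrite scalerDl.
congr (_ + _); rewrite scale_tpure mulr1 tpureM.
by rewrite [_ *: _]scaleM mulr1.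
Qed.

(** Frobenius reciprocity: sending the tensor of u and n to u n v respects additivity in n, and
    respects the balancing relation by [evalnc_act]. *)
Lemma tgen_lift (V : lmodType B) (v : V) :
  (forall i (n : K^o), b i *: (n%:A *: v) = (op i n)%:A *: v) ->
  exists f : {linear T -> V}, f tgen = v.
Proof.
move=> bv; pose t (n : M) : V := ((n : K)%:A : B) *: v.
have tE u n : linext t (tsym u n) = u *: t n := linextU t u n.
have tensor_rel0 : {in Defs.span (@tensor_rel _ _ (plift b_rels) M),
    forall x, linext t x = 0}.
  move=> z /asboolP; elim=> [|a x y xR _ IH]; first exact: linear0.
  rewrite linearP /= IH addr0; suff -> : linext t x = 0 by rewrite scaler0.
  case: xR => [u n n'|u a' n].
    rewrite !linearB /= !tE /t.
    rewrite (_ : (n + n' : K)%:A = (n : K)%:A + (n' : K)%:A :> B); last exact: scalerDl.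
    by rewrite scalerDl scalerDr addrAC addrK subrr.
  have [r ->] := alg_pi_surj a'; rewrite linearB /= !tE -scalerA.
  by rewrite (pliftE b_rels) /t evalnc_act // [_ *: n]rep_scaleE subrr.
have [f fE] := quotmod_factor tensor_rel0.
by exists f; rewrite fE [LHS]tE /t !scale1r.
Qed.

End InducedCharacter.

(** What the weight theory uses of U(sl_2): the relations, the Casimir element and, as an induction
    principle, generation by e, h, f. *)
Record sl2_algebra (K : numFieldType) (U : algType K) (e h f c : U) : Prop := {
  sl2_algebra_he : h * e - e * h = 2%:R *: e;
  sl2_algebra_ef : e * f - f * e = h;
  sl2_algebra_hf : h * f - f * h = - (2%:R *: f);
  sl2_algebra_casimir : c = 4%:R * e * f + (h - 1) ^+ 2;
  sl2_algebra_ind : forall P : U -> Prop, P 1 ->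
    (forall a u v, P u -> P v -> P (a *: u + v)) ->
    (forall u, P u -> [/\ P (e * u), P (h * u) & P (f * u)]) -> forall u, P u
}.

(** * Weight vectors and chains *)

Section AlgebraScalars.
Variables (K : fieldType) (U : algType K) (V : lmodType U).
Implicit Types (a b : K) (u : U) (x : V).

Lemma scale_algC u a x : u *: (a%:A *: x) = a%:A *: (u *: x).
Proof. by rewrite !scalerA mulr_algl mulr_algr. Qed.

Lemma scale_algM a b x : (a%:A : U) *: ((b%:A : U) *: x) = ((a * b)%:A : U) *: x.
Proof. by rewrite scalerA mulr_algl scalerA. Qed.

Lemma scale_algK a : a != 0 ->
  cancel (fun x => (a%:A : U) *: x) (fun x => (a^-1%:A : U) *: x).
Proof. by move=> a0 x; rewrite scale_algM mulVf // !scale1r. Qed.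

End AlgebraScalars.

Section Sl2Modules.
Variables (K : numFieldType) (U : algType K) (e h f c : U).
Hypothesis Usl2 : sl2_algebra e h f c.

Let he := sl2_algebra_he Usl2.
Let ef := sl2_algebra_ef Usl2.
Let hf := sl2_algebra_hf Usl2.
Let cE := sl2_algebra_casimir Usl2.
Let U_ind := sl2_algebra_ind Usl2.

Implicit Types (p q : {poly K}) (w : K) (V W : lmodType U).

Local Notation cas_poly := (horner_alg c).

Lemma cas_polyX : cas_poly 'X = c. Proof. exact: horner_algX. Qed.
Lemma cas_polyC w : cas_poly w%:P = w%:A. Proof. exact: horner_algC. Qed.

Lemma casimir_comm u : c * u = u * c.
Proof.
have he2 := etrans he (scaler_nat 2 e).
have hf2 := etrans hf (congr1 -%R (scaler_nat 2 f)).
elim/U_ind: u => [|a u v IHu IHv|u IH]; first by rewrite mulr1 mul1r.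
  by rewrite mulrDr mulrDl -scalerAl -scalerAr IHu IHv.
have ce := sl2_casimir_e he2 ef; have ch := sl2_casimir_h he2 hf2.
have cf := sl2_casimir_f ef hf2; rewrite -cE in ce ch cf.
by split; rewrite mulrA ?ce ?ch ?cf -!mulrA IH.
Qed.

Lemma cas_poly_central p u : u * cas_poly p = cas_poly p * u.
Proof.
elim/poly_ind: p => [|p w IH]; first by rewrite rmorph0 mulr0 mul0r.
rewrite rmorphD rmorphM /= cas_polyX cas_polyC mulrDr mulrDl mulrA IH -!mulrA.
by rewrite -casimir_comm mulr_algl mulr_algr.
Qed.

(** * Weight vectors and the action of the Casimir element on them *)

Section Weights.
Variable V : lmodType (U).
Implicit Types x y : V.

(** The eigenvalue is written as a constant polynomial in c, so that weights and coefficients in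
    K[c] obey the same commutation rules. *)
Definition weight_vector w x := h *: x = cas_poly w%:P *: x.

Lemma cas_polyZC p u x : u *: (cas_poly p *: x) = cas_poly p *: (u *: x).
Proof. by rewrite !scalerA cas_poly_central. Qed.

Lemma weight_cas w p x : weight_vector w x -> weight_vector w (cas_poly p *: x).
Proof.
by rewrite /weight_vector [h *: (_ *: _)]cas_polyZC => ->; rewrite cas_polyZC.
Qed.

Lemma weight_e w x : weight_vector w x -> weight_vector (w + 2) (e *: x).
Proof.
rewrite /weight_vector => hx; rewrite scalerA (sl2_heE (etrans he (scaler_nat 2 _))).
rewrite scalerDl -scalerA hx cas_polyZC -scalerMnl polyCD rmorphD /=.
by rewrite polyC_natr rmorph_nat [RHS]scalerDl scaler_nat.
Qed.

Lemma weight_f w x : weight_vector w x -> weight_vector (w - 2) (f *: x).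
Proof.
rewrite /weight_vector => hx; rewrite scalerA.
rewrite (sl2_hfE (etrans hf (congr1 -%R (scaler_nat 2 _)))).
rewrite scalerBl -scalerA hx cas_polyZC -scalerMnl polyCB rmorphB /=.
by rewrite polyC_natr rmorph_nat [RHS]scalerBl scaler_nat.
Qed.

Lemma weight_shift_sqr w a x : weight_vector w x ->
  (h + a%:A) ^+ 2 *: x = cas_poly ((w + a) ^+ 2)%:P *: x.
Proof.
have h1 z : weight_vector w z -> (h + a%:A) *: z = cas_poly (w + a)%:P *: z.
  by move=> hz; rewrite scalerDl hz polyCD rmorphD /= [RHS]scalerDl (cas_polyC a).
move=> hx; rewrite expr2 -scalerA (h1 x hx) (h1 _ (weight_cas _ hx)).
by rewrite scalerA -rmorphM -polyCM expr2.
Qed.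

(** This is c = 4fe + (h+1)^2, where h + 1 acts by w + 1. *)
Lemma casimir_fe w x : weight_vector w x ->
  c *: x = 4%:R *: (f *: (e *: x)) + cas_poly ((w + 1) ^+ 2)%:P *: x.
Proof.
move=> wx; rewrite [in LHS](etrans cE (sl2_casimirE ef)).
by rewrite -(weight_shift_sqr 1 wx) scale1r [LHS]scalerDl -!scalerA.
Qed.

Lemma casimir_ef w x : weight_vector w x ->
  c *: x = 4%:R *: (e *: (f *: x)) + cas_poly ((w - 1) ^+ 2)%:P *: x.
Proof.
move=> wx; rewrite [in LHS]cE.
by rewrite -(weight_shift_sqr (- 1) wx) scaleN1r [LHS]scalerDl -!scalerA.
Qed.

Lemma casimir_scalar (a b : K) x y : y = a%:A *: x ->
  4%:R *: y + cas_poly b%:P *: x = (4%:R * a + b)%:A *: x.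
Proof.
move=> ->; rewrite cas_polyC scalerA -scalerDl; congr (_ *: _).
by rewrite scalerDl mulr_natl scalerMnl mulr_natl.
Qed.

Lemma casimir_fe_scalar w a x : weight_vector w x -> f *: (e *: x) = a%:A *: x ->
  c *: x = (4%:R * a + (w + 1) ^+ 2)%:A *: x.
Proof. by move=> wx; rewrite (casimir_fe wx) => /casimir_scalar. Qed.

Lemma casimir_highest w x : weight_vector w x -> e *: x = 0 ->
  c *: x = ((w + 1) ^+ 2)%:A *: x.
Proof. by move=> wx ex; rewrite (casimir_fe wx) ex !scaler0 add0r cas_polyC. Qed.

Lemma casimir_lowest w x : weight_vector w x -> f *: x = 0 ->
  c *: x = ((w - 1) ^+ 2)%:A *: x.
Proof. by move=> wx fx; rewrite (casimir_ef wx) fx !scaler0 add0r cas_polyC. Qed.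

Lemma cas_quarter p x y : 4%:R *: y = cas_poly p *: x ->
  y = cas_poly (4%:R^-1%:P * p) *: x.
Proof.
move=> y4; rewrite rmorphM -scalerA -y4 scalerA /= -(rmorph_nat cas_poly) /=.
rewrite -rmorphM -polyC_natr -polyCM mulVf ?pnatr_eq0 //.
by rewrite rmorph1 scale1r.
Qed.

(** Solves c = 4fe + (w+1)^2 for fe. That fe and ef act on weight vectors through K[c] makes the
    K[c]-span of a chain stable under e and f. *)
Lemma weight_fe w x : weight_vector w x ->
  f *: (e *: x) = cas_poly (4%:R^-1%:P * ('X - ((w + 1) ^+ 2)%:P)) *: x.
Proof.
move=> wx; apply: cas_quarter.
by rewrite rmorphB [RHS]scalerBl /= cas_polyX (casimir_fe wx) addrK.
Qed.

Lemma weight_ef w x : weight_vector w x ->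
  e *: (f *: x) = cas_poly (4%:R^-1%:P * ('X - ((w - 1) ^+ 2)%:P)) *: x.
Proof.
move=> wx; apply: cas_quarter.
by rewrite rmorphB [RHS]scalerBl /= cas_polyX (casimir_ef wx) addrK.
Qed.

End Weights.

Lemma weight_linear V W (g : {linear V -> W}) w x :
  weight_vector w x -> weight_vector w (g x).
Proof. by rewrite /weight_vector => wx; rewrite -linearZ_LR wx linearZ_LR. Qed.

(** Induction on [s]: applying h - w_i to the relation kills y_i and multiplies every other y_j by
    the nonzero scalar w_j - w_i. So the other y_j vanish, and then y_i does. *)
Lemma weight_indep V (w : int -> K) (y : int -> V) (s : seq int) :
  injective w -> (forall j, weight_vector (w j) (y j)) -> uniq s ->
  \sum_(j <- s) y j = 0 -> {in s, forall j, y j = 0}.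
Proof.
move=> w_inj; elim: s y => [//|i s IH] y wy /= /andP[is_ us].
rewrite big_cons => sum0.
have ys0 j : j \in s -> y j = 0.
  move=> js; have wji : w j - w i != 0.
    by rewrite subr_eq0 (inj_eq w_inj); apply: contra is_ => /eqP <-.
  suff : cas_poly (w j - w i)%:P *: y j = 0.
    move/(congr1 (fun z => cas_poly (w j - w i)^-1%:P *: z)).
    by rewrite scaler0 scalerA -rmorphM -polyCM mulVf // rmorph1 scale1r.
  apply: (IH (fun j => cas_poly (w j - w i)%:P *: y j)) (j) js => // [k|].
    exact: weight_cas.
  transitivity ((h - cas_poly (w i)%:P) *: (y i + \sum_(j <- s) y j)).
    rewrite scalerDr scalerBl (wy i) subrr add0r scaler_sumr.
    by apply: eq_bigr => k _; rewrite scalerBl (wy k) -scalerBl -rmorphB -polyCB.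
  by rewrite sum0 scaler0.
move=> j; rewrite inE => /orP[/eqP->|/ys0//].
by move: sum0; rewrite big_seq big1 ?addr0.
Qed.

(** * The chain of a weight vector and its span over K[c] *)

Section Chain.
Variables (V : lmodType (U)) (v : V).

Definition chain (j : int) : V :=
  match j with
  | Posz n => e ^+ n *: v
  | Negz n => f ^+ n.+1 *: v
  end.

Lemma exp_chain m n : e ^+ m *: chain (Posz n) = chain (Posz (m + n)).
Proof. by rewrite scalerA -exprD. Qed.

Variable xi : K.
Hypothesis v_weight : weight_vector xi v.

Lemma weight_chain j : weight_vector (xi + 2%:R * j%:~R) (chain j).
Proof.
case: j => n; elim: n => [|n IH].
- by rewrite /weight_vector /= expr0 scale1r mulr0 addr0.
- rewrite /= exprS -scalerA.
  rewrite (_ : _ + _ = xi + 2%:R * (Posz n)%:~R + 2); first exact: weight_e.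
  by rewrite -[n.+1]addn1 PoszD rmorphD mulrDr addrA mulr1.
- by have := weight_f v_weight; rewrite /= expr1 mulrN1.
- rewrite /= exprS -scalerA.
  rewrite (_ : _ + _ = xi + 2%:R * (Negz n)%:~R - 2); first exact: weight_f.
  by rewrite !NegzE -[n.+2]addn1 PoszD opprD rmorphD mulrDr addrA mulrN1.
Qed.

(** Going away from 0 the coefficient is 1; for negative [j], e meets a factor f and [weight_ef]
    turns ef into a polynomial in c. *)
Lemma chain_e j : exists p, e *: chain j = cas_poly p *: chain (j + 1).
Proof.
case: j => n.
  by exists 1; rewrite rmorph1 scale1r scalerA -exprS -[1]/(Posz 1) -PoszD addn1.
have step (x : V) w : weight_vector w x -> exists p, e *: (f *: x) = cas_poly p *: x.
  by move=> wx; eexists; exact: weight_ef wx.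
case: n => [|n]; rewrite [chain _]/= exprS -scalerA.
  rewrite expr0 scale1r; have [p ->] := step _ _ v_weight.
  by exists p; rewrite /= expr0 scale1r.
have -> : Negz n.+1 + 1 = Negz n by rewrite !NegzE -[n.+2]addn1 PoszD opprD subrK.
by have [p ->] := step _ _ (weight_chain (Negz n)); exists p.
Qed.

Lemma chain_f j : exists p, f *: chain j = cas_poly p *: chain (j - 1).
Proof.
case: j => [[|n]|n].
- by exists 1; rewrite rmorph1 scale1r /= expr0 expr1 scale1r.
- rewrite [chain _]/= exprS -scalerA (weight_fe (weight_chain n)).
  by eexists; rewrite (_ : Posz n.+1 - 1 = n) // -[n.+1]addn1 PoszD addrK.
- exists 1; rewrite rmorph1 scale1r scalerA -exprS.
  by rewrite (_ : Negz n - 1 = Negz n.+1) // !NegzE -[n.+2]addn1 PoszD opprD.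
Qed.

(** The coefficients form a total function vanishing off the support, so that two sums can be added
    over the union of their supports. *)
Definition chain_sum x := exists (s : {fset int}) (p : int -> {poly K}),
  (forall j, j \notin s -> p j = 0) /\
  x = \sum_(j <- s) cas_poly (p j) *: chain j.

Lemma chain_sum0 : chain_sum 0.
Proof. by exists fset0, (fun=> 0); rewrite big_seq_fset0. Qed.

Lemma chain_sumD x y : chain_sum x -> chain_sum y -> chain_sum (x + y).
Proof.
move=> [s [p [p0 ->]]] [t [q [q0 ->]]].
exists (s `|` t)%fset, (fun j => p j + q j); split.
  by move=> j; rewrite inE negb_or => /andP[/p0-> /q0->]; rewrite addr0.
rewrite (big_fset_incl _ (fsubsetUl s t)) => [|j _ /p0->]; last by rewrite rmorph0 scale0r.
rewrite (big_fset_incl _ (fsubsetUr s t)) => [|j _ /q0->]; last by rewrite rmorph0 scale0r.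
by rewrite -big_split; apply: eq_bigr => j _; rewrite rmorphD scalerDl.
Qed.

Lemma chain_sum1 p j : chain_sum (cas_poly p *: chain j).
Proof.
exists [fset j]%fset, (fun k => if k == j then p else 0); split.
  by move=> k; rewrite inE => /negPf->.
by rewrite big_seq_fset1 eqxx.
Qed.

Lemma chain_sum_op (u : U) x :
  (forall j, exists p k, u *: chain j = cas_poly p *: chain k) ->
  chain_sum x -> chain_sum (u *: x).
Proof.
move=> uP [s [p [_ ->]]]; rewrite scaler_sumr.
elim/big_ind: _ => [||j _]; [exact: chain_sum0 | exact: chain_sumD |].
have [q [k uj]] := uP j; rewrite cas_polyZC uj scalerA -rmorphM.
exact: chain_sum1.
Qed.

(** The K[c]-span of the chain contains [v] and is stable under scalars, e, h and f. *)
Lemma cyclic_chain_sum u : chain_sum (u *: v).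
Proof.
elim/U_ind: u => [|a x y Px Py|u Pu].
- have := chain_sum1 1 0; rewrite rmorph1 /= expr0; by rewrite !scale1r.
- rewrite scalerDl; apply: chain_sumD => //; rewrite -mulr_algl -scalerA -cas_polyC.
  by apply: chain_sum_op Px => j; exists a%:P, j.
- split; rewrite -scalerA; apply: chain_sum_op Pu => j.
  + by have [p ep] := chain_e j; exists p, (j + 1).
  + by exists (xi + 2%:R * j%:~R)%:P, j; exact: weight_chain.
  + by have [p fp] := chain_f j; exists p, (j - 1).
Qed.

End Chain.

Lemma chain_linear V W (g : {linear V -> W}) v j : g (chain v j) = chain (g v) j.
Proof. by case: j => n; rewrite /= linearZ. Qed.

(** If [g] kills a chain sum, the images of its terms are weight vectors of distinct weights with
    sum 0. Each image vanishes by [weight_indep], and then each term by hypothesis. *)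
Lemma cyclic_injective V W (g : {linear V -> W}) v xi :
  weight_vector xi v -> (forall x, exists u, x = u *: v) ->
  (forall j p, cas_poly p *: chain (g v) j = 0 -> cas_poly p *: chain v j = 0) ->
  forall x, g x = 0 -> x = 0.
Proof.
move=> v_weight v_gen g_chain x; have [u ->] := v_gen x.
have [s [p [_ ->]]] := cyclic_chain_sum v_weight u.
rewrite linear_sum => /(weight_indep (w := fun j => xi + 2%:R * j%:~R)) gp0.
rewrite big_seq big1 // => j js; apply: g_chain; rewrite -chain_linear -linearZ.
apply: gp0 js => //; last exact: fset_uniq.
  (* The weights xi + 2j are distinct because the characteristic is 0. *)
  move=> i k /addrI /(mulfI _) => /(_ _)/intr_inj; apply.
  by rewrite pnatr_eq0.
by move=> k; apply/weight_linear/weight_cas/weight_chain.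
Qed.

Lemma cas_poly_linear V q : linear (fun x : V => cas_poly q *: x).
Proof. by move=> u x y; rewrite scalerDr cas_polyZC. Qed.

(** Multiplication by q(c) is an endomorphism. If it kills p(c) v_j, then pq = 0 by freeness and p =
    0. *)
Lemma cas_poly_torsion_free V (v : V) xi q :
  weight_vector xi v -> (forall x : V, exists u, x = u *: v) ->
  (forall j p, cas_poly p *: chain v j = 0 -> p = 0) -> q != 0 ->
  forall x : V, cas_poly q *: x = 0 -> x = 0.
Proof.
move=> v_weight v_gen v_free q0.
pose g := HB.pack_for {linear V -> V} (fun x : V => cas_poly q *: x)
  (GRing.isLinear.Build U V V _ (fun x : V => cas_poly q *: x) (cas_poly_linear q)).
apply: (cyclic_injective (g := g) v_weight v_gen) => j p.
rewrite -chain_linear /= scalerA -rmorphM => /v_free/eqP.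
by rewrite mulf_eq0 (negPf q0) orbF => /eqP->; rewrite rmorph0 scale0r.
Qed.

(** Multiplication by q(c) maps V onto B = qV; as V has no q-torsion, the preimage of A = qrV is S =
    rV. *)
Lemma cas_poly_subquot V (v : V) xi q r (B A S : submodClosed V) :
  weight_vector xi v -> (forall x : V, exists u, x = u *: v) ->
  (forall j p, cas_poly p *: chain v j = 0 -> p = 0) -> q != 0 ->
  (forall x, x \in B <-> exists y, x = cas_poly q *: y) ->
  (forall x, x \in A <-> exists y, x = cas_poly (q * r) *: y) ->
  (forall x, x \in S <-> exists y, x = cas_poly r *: y) ->
  isomorphic (subquot B A) (quotmod S).
Proof.
move=> v_weight v_gen v_free q0 memB memA memS.
pose g := HB.pack_for {linear V -> V} (fun x : V => cas_poly q *: x)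
  (GRing.isLinear.Build U V V _ (fun x : V => cas_poly q *: x) (cas_poly_linear q)).
apply: (subquot_iso (g := g)) => [x|y /memB//|x]; first by apply/memB; exists x.
apply/idP/idP => [/memA|/memS] [y xy]; [apply/memS | apply/memA]; exists y.
  apply/eqP; rewrite -subr_eq0; apply/eqP.
  apply: (cas_poly_torsion_free v_weight v_gen v_free q0).
  by rewrite scalerBr [X in X - _]xy rmorphM scalerA subrr.
by rewrite xy /= scalerA -rmorphM.
Qed.

(** * Cyclic modules on which c acts by a scalar *)

Section CentralCharacter.
Variables (V : lmodType U) (v : V) (tau : K).
Hypothesis v_cas : c *: v = tau%:A *: v.

Lemma casimir_cyclic u : c *: (u *: v) = tau%:A *: (u *: v).
Proof. by rewrite scalerA casimir_comm -scalerA v_cas scale_algC. Qed.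

Lemma cas_chain j : c *: chain v j = tau%:A *: chain v j.
Proof. by case: j => n; exact: casimir_cyclic. Qed.

Lemma cas_poly_eval p (x : V) : c *: x = tau%:A *: x ->
  cas_poly p *: x = p.[tau]%:A *: x.
Proof.
move=> cx; elim/poly_ind: p => [|p a IH].
  by rewrite rmorph0 horner0 !scale0r.
rewrite rmorphD rmorphM /= cas_polyX cas_polyC scalerDl -scalerA cx.
rewrite -(cas_polyC tau) cas_polyZC IH hornerMXaddC cas_polyC scalerA mulr_algl.
rewrite -scalerDl scalerA.
by rewrite -scalerDl mulrC.
Qed.

End CentralCharacter.

(** Here K[c] v_j consists of the scalar multiples of v_j, so injectivity on it means that v_j is 0
    or has nonzero image. *)
Lemma cyclic_injective_central V W (g : {linear V -> W}) v xi tau :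
  weight_vector xi v -> (forall x, exists u, x = u *: v) -> c *: v = tau%:A *: v ->
  (forall j, chain v j = 0 \/ chain (g v) j <> 0) -> forall x, g x = 0 -> x = 0.
Proof.
move=> v_weight v_gen v_cas g_chain.
apply: (cyclic_injective v_weight v_gen) => j p.
have [-> _|gj] := g_chain j; first by rewrite scaler0.
rewrite -chain_linear -linearZ_LR (cas_poly_eval p (cas_chain v_cas j)).
rewrite linearZ_LR chain_linear.
have [->|p0] := eqVneq p.[tau] 0; first by rewrite !scale0r.
by move=> /(congr1 ( *:%R p.[tau]^-1%:A)); rewrite scale_algK // scaler0.
Qed.

End Sl2Modules.

(** * A weight module on functions *)

Section WeightModel.
Variables (K : numFieldType) (xi tau : K).
Implicit Types (phi : int -> K^o) (j : int).

(* [f e] acts on the chain vector of index [j] by [fe_coef j], when [c = tau]. *)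
Definition fe_coef j : K := 4%:R^-1 * (tau - (xi + 2%:R * j%:~R + 1) ^+ 2).
(* A factorization of [fe_coef] into the coefficients of [e] and [f], chosen so
   that the chain of the indicator function of 0 consists of indicator functions. *)
Definition up_coef j : K := if 0 <= j then 1 else fe_coef j.
Definition down_coef j : K := if j <= 0 then 1 else fe_coef (j - 1).

Lemma up_down_coef j : up_coef j * down_coef (j + 1) = fe_coef j.
Proof.
rewrite /up_coef /down_coef addrK; case: ifP => j0; first by rewrite lezD1 ltNge j0 mul1r.
by rewrite lezD1 ltNge j0 mulr1.
Qed.

(** In terms of indicator functions, e sends that of j to [up_coef j] times that of j + 1, and f
    sends it to [down_coef j] times that of j - 1. The functions may have infinite support. *)
Definition model_fun (i : sl2_gen) phi : int -> K^o :=
  match i with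
  | Ge => fun j => up_coef (j - 1) * phi (j - 1)
  | Gh => fun j => (xi + 2%:R * j%:~R) * phi j
  | Gf => fun j => down_coef (j + 1) * phi (j + 1)
  end.

Lemma model_fun_linear i : linear (model_fun i).
Proof.
move=> a phi psi; apply/funext => j; case: i => /=;
  by rewrite /= !fctE mulrDr scalerAr.
Qed.
HB.instance Definition _ i := GRing.isLinear.Build K (int -> K^o) (int -> K^o) _
  (model_fun i) (model_fun_linear i).

Lemma model_rels r : r \in sl2_rels K ->
  forall phi, act (fun i => model_fun i : {linear _ -> _}) r phi = 0.
Proof.
have n4 : 4%:R != 0 :> K by rewrite pnatr_eq0.
have scaleE (a : K) (b : K^o) : a *: b = a * b by [].
rewrite !inE => /or3P[] /eqP-> phi; apply/funext => j;
  rewrite !(actD, actN, actZ, actM, act_fvar) /= !fctE /= -[RHS]/(0 : K).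
- by rewrite rmorphB /= scaleE; ring.
(* At index j, ef acts by [fe_coef (j - 1)] and fe by [fe_coef j]; the difference is the weight xi +
   2j. *)
- rewrite !mulrA (addrK 1 j) (subrK 1 j) (mulrC (down_coef _)) up_down_coef.
  have := up_down_coef (j - 1); rewrite subrK => ->.
  by rewrite /fe_coef rmorphB /=; field.
- by rewrite rmorphD /= scaleE; ring.
Qed.

Definition model := repmod (Rep model_rels).

Definition basis_fun j : model := fun k => (k == j)%:R.

End WeightModel.

(** * Indicator functions in the model *)

Section ModelTheory.
Variables (K : numFieldType).
Local Notation U := (usl2 K).
Local Notation weight := (weight_vector (sl2_h K) (casimir K)).
Local Notation chain := (chain (sl2_e K) (sl2_f K)).

Lemma usl2_sl2_algebra : sl2_algebra (sl2_e K) (sl2_h K) (sl2_f K) (casimir K).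
Proof.
split=> [||||P P1 PD PM]; [exact: usl2_he | exact: usl2_ef | exact: usl2_hf | by [] |].
by apply: usl2_ind => // -[] u /PM[].
Qed.

(** Identifies the scalars of [K] acting through U(sl_2) with those of the underlying vector
    space. *)
Lemma usl2_repmod_scalar (M : rep (sl2_rels K)) (a : K) (x : repmod M) :
  (a%:A : U) *: x = a *: (x : rep_sort M).
Proof.
have -> : (a%:A : U) = alg_pi _ (a%:A) by exact/esym/alg_piZ.
by rewrite [LHS]rep_scaleE actZ act1.
Qed.

Lemma usl2_weightP (V : lmodType U) w (x : V) :
  weight w x <-> sl2_h K *: x = (w%:A : U) *: x.
Proof. by rewrite /weight_vector cas_polyC. Qed.

Variables (xi tau : K).
Local Notation delta := (basis_fun xi tau).

Lemma model_e phi : sl2_e K *: (phi : model xi tau) = model_fun xi tau Ge phi.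
Proof. exact: pvar_scale. Qed.
Lemma model_h phi : sl2_h K *: (phi : model xi tau) = model_fun xi tau Gh phi.
Proof. exact: pvar_scale. Qed.
Lemma model_f phi : sl2_f K *: (phi : model xi tau) = model_fun xi tau Gf phi.
Proof. exact: pvar_scale. Qed.

Lemma weight_basis_fun j : weight (xi + 2%:R * j%:~R) (delta j).
Proof.
apply/usl2_weightP; rewrite model_h usl2_repmod_scalar; apply/funext => k.
transitivity ((xi + 2%:R * k%:~R) * delta j k : K); first by [].
transitivity ((xi + 2%:R * j%:~R) * delta j k : K); last by [].
by rewrite /basis_fun; case: eqP => [->//|_]; rewrite !mulr0n !mulr0.
Qed.

Lemma e_basis_fun j : sl2_e K *: delta j = ((up_coef xi tau j)%:A : U) *: delta (j + 1).
Proof.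
rewrite model_e usl2_repmod_scalar; apply/funext => k.
transitivity (up_coef xi tau (k - 1) * delta j (k - 1) : K); first by [].
transitivity (up_coef xi tau j * delta (j + 1) k : K); last by [].
rewrite /basis_fun subr_eq; case: eqP => [->|_]; first by rewrite addrK.
by rewrite !mulr0n !mulr0.
Qed.

Lemma f_basis_fun j : sl2_f K *: delta j = ((down_coef xi tau j)%:A : U) *: delta (j - 1).
Proof.
rewrite model_f usl2_repmod_scalar; apply/funext => k.
transitivity (down_coef xi tau (k + 1) * delta j (k + 1) : K); first by [].
transitivity (down_coef xi tau j * delta (j - 1) k : K); last by [].
rewrite /basis_fun -(can2_eq (addrK 1) (subrK 1)); case: eqP => [<-|_].
  by [].
by rewrite !mulr0n !mulr0.
Qed.

Lemma basis_fun_casimir : casimir K *: delta 0 = (tau%:A : U) *: delta 0.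
Proof.
have wd : weight xi (delta 0) by have := weight_basis_fun 0; rewrite mulr0 addr0.
rewrite (casimir_fe_scalar (a := fe_coef xi tau 0) usl2_sl2_algebra wd).
  congr (_%:A *: _); rewrite /fe_coef mulr0 addr0 mulrA mulfV ?mul1r ?subrK //.
  by rewrite pnatr_eq0.
rewrite e_basis_fun scale_algC f_basis_fun scale_algM addrK.
by rewrite -up_down_coef.
Qed.

(** Moving away from index 0 only meets coefficients [up_coef] at j >= 0 and [down_coef] at j <= 0,
    all equal to 1. *)
Lemma chain_basis_fun j : chain (delta 0) j = delta j.
Proof.
case: j => n; elim: n => [|n IH].
- by rewrite /= expr0 scale1r.
- rewrite /= exprS -scalerA; move: IH => /= ->; rewrite e_basis_fun /up_coef.
  by rewrite lez_nat /= !scale1r -[n.+1]addn1 PoszD.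
- by rewrite /= expr1 f_basis_fun /down_coef lexx !scale1r.
- rewrite /= exprS -scalerA; move: IH => /= ->; rewrite f_basis_fun /down_coef.
  by rewrite /= !scale1r !NegzE -[n.+2]addn1 PoszD opprD.
Qed.

End ModelTheory.

(** * The modules X(xi) and V(xi + 2Z, tau) *)

Section UniversalWeightModule.
Variables (K : numFieldType) (xi : K).
Local Notation U := (usl2 K).
Local Notation cas_poly := (horner_alg (casimir K)).
Local Notation weight := (weight_vector (sl2_h K) (casimir K)).
Local Notation chain := (chain (sl2_e K) (sl2_f K)).
Local Notation Usl2 := (usl2_sl2_algebra K).

Definition xgen : X xi := tgen (@uh_to_usl2_rels K) (@charh_rels K xi).

Lemma xgen_weight : weight xi xgen.
Proof.
apply/usl2_weightP.
by have := pvar_tgen (@uh_to_usl2_rels K) (@charh_rels K xi) tt; rewrite /= /homothety mulr1.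
Qed.

Lemma xgen_cyclic (x : X xi) : exists u, x = u *: xgen.
Proof. exact: tgen_cyclic. Qed.

Lemma xgen_lift (V : lmodType U) (v : V) : weight xi v ->
  exists g : {linear X xi -> V}, g xgen = v.
Proof.
move=> /usl2_weightP hv.
apply: (tgen_lift (@uh_to_usl2_rels K) (@charh_rels K xi)) => _ n.
by rewrite scale_algC hv scale_algM mulrC.
Qed.

(** For each tau, the map from X(xi) to the model sends p(c) v_j to p(tau) times the indicator of j.
    Hence p vanishes at every tau, and p = 0 since [K] is infinite. *)
Lemma xgen_free j p : cas_poly p *: chain xgen j = 0 -> p = 0.
Proof.
move=> pj0; apply/eqP/negPn/negP => p0.
have root_p (tau : K) : root p tau.
  have w0 : weight xi (basis_fun xi tau 0).
    by have := weight_basis_fun xi tau 0; rewrite mulr0 addr0.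
  have [g gx] := xgen_lift w0.
  have := congr1 g pj0; rewrite linear0 (linearZ_LR g) chain_linear gx => pd.
  have := cas_poly_eval Usl2 p (cas_chain Usl2 (basis_fun_casimir xi tau) j).
  rewrite [LHS]pd chain_basis_fun usl2_repmod_scalar => /(congr1 (fun phi => phi j)) pj.
  have : 0 = p.[tau] * basis_fun xi tau j j by exact: pj.
  by rewrite /basis_fun eqxx mulr1 => /esym/eqP.
(* The numbers 0, ..., [size p] - 1 would be [size p] distinct roots, more than the degree
   allows. *)
have uniq_nat : uniq [seq n%:R : K | n <- iota 0 (size p)].
  by rewrite map_inj_uniq ?iota_uniq // => m n /eqP; rewrite eqr_nat => /eqP.
suff /(max_poly_roots p0)/(_ uniq_nat) :
    all (root p) [seq n%:R : K | n <- iota 0 (size p)].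
  by rewrite size_map size_iota ltnn.
by apply/allP => ? _; exact: root_p.
Qed.

Variable tau : K.

Lemma cas_img_sub k : {subset cas_img tau k.+1 (X xi) <= cas_img tau k (X xi)}.
Proof.
move=> _ /asboolP[x ->]; apply/asboolP; exists ((casimir K - tau%:A) *: x).
by rewrite scalerA exprSr.
Qed.

Lemma mem_cas_img (V : lmodType U) k (x : V) :
  x \in cas_img tau k V <-> exists y, x = cas_poly (('X - tau%:P) ^+ k) *: y.
Proof.
have -> : cas_poly (('X - tau%:P) ^+ k) = (casimir K - tau%:A) ^+ k.
  by rewrite rmorphXn rmorphB /= cas_polyX cas_polyC.
by split=> [/asboolP|xk]; last apply/asboolP.
Qed.

Lemma filtration_subquot k :
  isomorphic (subquot (cas_img tau k (X xi)) (cas_img tau k.+1 (X xi)))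
             (Xbar xi tau).
Proof.
(* The factor [r] is kept as a first power to match [cas_img tau 1] in the definition of [Xbar]. *)
apply: (cas_poly_subquot (q := ('X - tau%:P) ^+ k) (r := ('X - tau%:P) ^+ 1)
  Usl2 xgen_weight xgen_cyclic xgen_free).
- by rewrite expf_neq0 // polyXsubC_eq0.
- exact: mem_cas_img.
- by move=> x; rewrite -exprD addn1; exact: mem_cas_img.
- exact: mem_cas_img.
Qed.

Definition xbargen : Xbar xi tau := qcl _ xgen.

Lemma xbargen_weight : weight xi xbargen.
Proof. exact: weight_linear xgen_weight. Qed.

Lemma xbargen_cyclic (x : Xbar xi tau) : exists u, x = u *: xbargen.
Proof.
have [y ->] := qcl_surj x; have [u ->] := xgen_cyclic y.
by exists u; rewrite linearZ_LR.
Qed.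

Lemma xbargen_casimir : casimir K *: xbargen = (tau%:A : U) *: xbargen.
Proof.
apply/eqP; rewrite -subr_eq0 -scalerBl -linearZ_LR -(qcl0 (cas_img tau 1 (X xi))).
by apply/eqP/qclP/asboolP; exists xgen; rewrite subr0.
Qed.

(** The lift from X(xi) kills (c - tau)X(xi), because c acts by tau on everything generated by
    [v]. *)
Lemma xbargen_lift (V : lmodType U) (v : V) : weight xi v ->
  casimir K *: v = (tau%:A : U) *: v ->
  exists g : {linear Xbar xi tau -> V}, g xbargen = v.
Proof.
move=> v_weight v_cas; have [g gx] := xgen_lift v_weight.
have [_ /asboolP[x ->]|gbar gbarE] := @quotmod_factor _ _ _ (cas_img tau 1 (X xi)) g.
  have [u ->] := xgen_cyclic x.
  by rewrite !(linearZ_LR g) gx expr1 scalerBl (casimir_cyclic Usl2 v_cas) subrr.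
by exists gbar; rewrite gbarE.
Qed.

End UniversalWeightModule.

(** * The generic case: comparison with V(xi + 2Z, tau) *)

Section DenseIso.
Variables (K : numFieldType) (xi tau : K).
Local Notation U := (usl2 K).
Local Notation weight := (weight_vector (sl2_h K) (casimir K)).
Local Notation chain := (chain (sl2_e K) (sl2_f K)).
Local Notation Usl2 := (usl2_sl2_algebra K).

Lemma coset_origin_subproof : `[< exists k : int, xi = xi + (2 * k)%:~R >].
Proof. by apply/asboolP; exists 0; rewrite mulr0 addr0. Qed.
Definition coset_origin : coset xi := exist _ xi coset_origin_subproof.

Definition dense_vec (k : int) : dense xi tau :=
  wvec (coset_shift k coset_origin).

Lemma dense_vec_neq0 k : dense_vec k <> 0.
Proof.
move/(congr1 (mcoeff (coset_shift k coset_origin))).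
by rewrite mcoeffUU mcoeff0 => /eqP; rewrite oner_eq0.
Qed.

Lemma dense_vec_e k :
  sl2_e K *: dense_vec k = ((fe_coef xi tau k)%:A : U) *: dense_vec (k + 1).
Proof.
rewrite usl2_repmod_scalar [LHS]pvar_scale [LHS]dense_eE coset_shiftD /=.
by rewrite /fe_coef intrM.
Qed.

Lemma dense_vec_h k :
  sl2_h K *: dense_vec k = ((xi + 2%:R * k%:~R)%:A : U) *: dense_vec k.
Proof.
by rewrite usl2_repmod_scalar [LHS]pvar_scale [LHS]dense_hE /= intrM.
Qed.

Lemma dense_vec_f k : sl2_f K *: dense_vec k = dense_vec (k - 1).
Proof. by rewrite [LHS]pvar_scale [LHS]dense_fE coset_shiftD. Qed.

Lemma dense_vec_weight : weight xi (dense_vec 0).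
Proof. by apply/usl2_weightP; rewrite dense_vec_h mulr0 addr0. Qed.

Lemma dense_vec_casimir : casimir K *: dense_vec 0 = (tau%:A : U) *: dense_vec 0.
Proof.
rewrite (casimir_fe_scalar (a := fe_coef xi tau 0) Usl2 dense_vec_weight).
  congr (_%:A *: _); rewrite /fe_coef mulr0 addr0 mulrA mulfV ?mul1r ?subrK //.
  by rewrite pnatr_eq0.
by rewrite dense_vec_e scale_algC dense_vec_f addrK.
Qed.

Hypothesis tau_generic : forall j : nat, tau - (xi + 2%:R * j%:R + 1) ^+ 2 != 0.

(** Upwards, the scalar is the product of the [fe_coef] met on the way, nonzero by genericity;
    downwards, f has coefficient 1. *)
Lemma chain_dense_vec j : exists2 a : K, a != 0 &
  chain (dense_vec 0) j = (a%:A : U) *: dense_vec j.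
Proof.
case: j => n; elim: n => [|n [a a0 IH]].
- by exists 1; [exact: oner_neq0 | rewrite /= expr0 !scale1r].
- exists (a * fe_coef xi tau n).
    by rewrite mulf_neq0 // /fe_coef mulf_neq0 ?invr_eq0 ?pnatr_eq0 //; exact: tau_generic.
  rewrite /= exprS -scalerA; move: IH => /= ->; rewrite scale_algC dense_vec_e.
  by rewrite scale_algM -[n.+1]addn1 PoszD.
- by exists 1; [exact: oner_neq0 | rewrite /= expr1 !scale1r dense_vec_f].
- exists a; first exact: a0.
  rewrite /= exprS -scalerA; move: IH => /= ->.
  by rewrite scale_algC dense_vec_f !NegzE -[n.+2]addn1 PoszD opprD.
Qed.

(** The generator goes to v_xi. By [chain_dense_vec] the chain goes to nonzero multiples of all the
    basis vectors, which gives both injectivity and surjectivity. *)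
Lemma Xbar_dense_iso : isomorphic (Xbar xi tau) (dense xi tau).
Proof.
have [g gE] := xbargen_lift dense_vec_weight dense_vec_casimir.
apply: (lin_iso (f := g)) => [|y].
  apply: (cyclic_injective_central Usl2 (xbargen_weight xi tau)
    (@xbargen_cyclic _ xi tau) (xbargen_casimir xi tau)) => j.
  right; rewrite gE; have [a a0 ->] := chain_dense_vec j.
  move/(congr1 ( *:%R (a^-1%:A : U))); rewrite scale_algK // scaler0.
  exact: dense_vec_neq0.
have vecP k : exists x, dense_vec k = g x.
  have [a a0 ck] := chain_dense_vec k.
  exists ((a^-1%:A : U) *: chain (xbargen xi tau) k).
  by rewrite linearZ_LR chain_linear gE ck scale_algK.
rewrite [y]monalgE; elim: (enum_fset _) => [|eta s [x xE]].
  by exists 0; rewrite big_nil linear0.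
rewrite big_cons; have /asboolP[k etaE] := valP eta.
have [z zE] := vecP k.
exists (((y@_eta)%:A : U) *: z + x); rewrite linearP -zE -xE; congr (_ + _).
rewrite usl2_repmod_scalar.
have -> : eta = coset_shift k coset_origin by exact: val_inj.
by apply/esym/(etrans (scale_mkmalgU _ _ _)); rewrite mulr1.
Qed.

End DenseIso.

(** * The degenerate case *)

Section CyclicSubmodule.
Variables (R : pzRingType) (V : lmodType R) (y : V).

Definition cyclic : {pred V} := fun x => `[< exists u, x = u *: y >].

Lemma cyclic_closed : subsemimod_closed cyclic.
Proof.
split; first split.
- by apply/asboolP; exists 0; rewrite scale0r.
- move=> _ _ /asboolP[u ->] /asboolP[v ->]; apply/asboolP.
  by exists (u + v); rewrite scalerDl.
- move=> a _ /asboolP[u ->]; apply/asboolP; exists (a * u); exact: scalerA.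
Qed.
HB.instance Definition _ :=
  GRing.isSubSemiModClosed.Build R V cyclic cyclic_closed.

Definition cyclic_submod : submodClosed V := cyclic.

Lemma cyclic_gen : y \in cyclic.
Proof. by apply/asboolP; exists 1; rewrite scale1r. Qed.

End CyclicSubmodule.

(** * Generators and universal properties of the Verma modules *)

Section VermaModules.
Variables (K : numFieldType) (delta : K).
Local Notation U := (usl2 K).
Local Notation weight := (weight_vector (sl2_h K) (casimir K)).
Local Notation Usl2 := (usl2_sl2_algebra K).

Definition hwgen : VermaHigh delta :=
  tgen (@bplus_to_usl2_rels K) (@charb_rels K 2%:R delta).
Definition lwgen : VermaLow delta :=
  tgen (@bminus_to_usl2_rels K) (@charb_rels K (- 2%:R) delta).

Lemma hwgen_cyclic (x : VermaHigh delta) : exists u, x = u *: hwgen.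
Proof. exact: tgen_cyclic. Qed.
Lemma lwgen_cyclic (x : VermaLow delta) : exists u, x = u *: lwgen.
Proof. exact: tgen_cyclic. Qed.

Lemma hwgen_weight : weight delta hwgen.
Proof.
apply/usl2_weightP.
have := pvar_tgen (@bplus_to_usl2_rels K) (@charb_rels K 2%:R delta) true.
by rewrite /= /homothety mulr1.
Qed.
Lemma lwgen_weight : weight delta lwgen.
Proof.
apply/usl2_weightP.
have := pvar_tgen (@bminus_to_usl2_rels K) (@charb_rels K (- 2%:R) delta) true.
by rewrite /= /homothety mulr1.
Qed.

Lemma hwgen_e : sl2_e K *: hwgen = 0.
Proof.
have := pvar_tgen (@bplus_to_usl2_rels K) (@charb_rels K 2%:R delta) false.
by rewrite /= !scale0r.
Qed.
Lemma lwgen_f : sl2_f K *: lwgen = 0.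
Proof.
have := pvar_tgen (@bminus_to_usl2_rels K) (@charb_rels K (- 2%:R) delta) false.
by rewrite /= !scale0r.
Qed.

Lemma hwgen_casimir : casimir K *: hwgen = (((delta + 1) ^+ 2)%:A : U) *: hwgen.
Proof. exact: (casimir_highest Usl2 hwgen_weight hwgen_e). Qed.
Lemma lwgen_casimir : casimir K *: lwgen = (((delta - 1) ^+ 2)%:A : U) *: lwgen.
Proof. exact: (casimir_lowest Usl2 lwgen_weight lwgen_f). Qed.

Lemma hwgen_lift (V : lmodType U) (v : V) :
  weight delta v -> sl2_e K *: v = 0 ->
  exists g : {linear VermaHigh delta -> V}, g hwgen = v.
Proof.
move=> /usl2_weightP hv ev.
apply: (tgen_lift (@bplus_to_usl2_rels K) (@charb_rels K 2%:R delta)) => -[] n.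
  by rewrite scale_algC hv scale_algM mulrC.
by rewrite scale_algC ev scaler0 !scale0r.
Qed.
Lemma lwgen_lift (V : lmodType U) (v : V) :
  weight delta v -> sl2_f K *: v = 0 ->
  exists g : {linear VermaLow delta -> V}, g lwgen = v.
Proof.
move=> /usl2_weightP hv fv.
apply: (tgen_lift (@bminus_to_usl2_rels K) (@charb_rels K (- 2%:R) delta)) => -[] n.
  by rewrite scale_algC hv scale_algM mulrC.
by rewrite scale_algC fv scaler0 !scale0r.
Qed.

End VermaModules.

(** * The submodule Y, its quotient, and their identification with Verma modules *)

Section Degenerate.
Variables (K : numFieldType) (xi tau : K) (j0 : nat).
Local Notation U := (usl2 K).
Local Notation weight := (weight_vector (sl2_h K) (casimir K)).
Local Notation chain := (chain (sl2_e K) (sl2_f K)).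
Local Notation Usl2 := (usl2_sl2_algebra K).
Hypothesis tau_j0 : tau - (xi + 2%:R * j0%:R + 1) ^+ 2 = 0.
Hypothesis tau_lt_j0 : forall j : nat, (j < j0)%N ->
  tau - (xi + 2%:R * j%:R + 1) ^+ 2 != 0.

Local Notation xbar := (xbargen xi tau).
Local Notation ladder := (chain xbar).
Local Notation coef := (fe_coef xi tau).

Lemma fe_coef_j0 : coef j0 = 0.
Proof. by rewrite /fe_coef [X in _ * X]tau_j0 mulr0. Qed.

Lemma fe_coef_neq0 (j : nat) : (j < j0)%N -> coef j != 0.
Proof.
by move=> jj0; rewrite mulf_neq0 ?invr_eq0 ?pnatr_eq0 //; exact: tau_lt_j0.
Qed.

Lemma f_ladderS (n : nat) :
  sl2_f K *: ladder n.+1 = ((coef n)%:A : U) *: ladder n.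
Proof.
rewrite [ladder n.+1]/= exprS -scalerA.
rewrite (weight_fe Usl2 (weight_chain Usl2 (xbargen_weight xi tau) n)).
rewrite (cas_poly_eval Usl2 _ (cas_chain Usl2 (xbargen_casimir xi tau) n)).
by rewrite hornerM hornerC hornerXsubC.
Qed.

(** The scalar is the product of [coef j] for j < k, nonzero by minimality of [j0]. Thus v_{j0}
    generates the whole module. *)
Lemma f_ladder_down (k : nat) : (k <= j0)%N -> exists2 a : K, a != 0 &
  sl2_f K ^+ k *: ladder k = (a%:A : U) *: xbar.
Proof.
elim: k => [_|k IH kj0].
  by exists 1; [exact: oner_neq0 | rewrite /= !expr0 !scale1r].
have [a a0 aE] := IH (ltnW kj0).
exists (coef k * a); first by rewrite mulf_neq0 ?fe_coef_neq0.
by rewrite exprSr -scalerA f_ladderS scale_algC aE scale_algM.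
Qed.

(** Used to show that ladder vectors are nonzero or lie outside Y. *)
Lemma to_model : exists g : {linear Xbar xi tau -> model xi tau},
  forall j, g (ladder j) = basis_fun xi tau j.
Proof.
have w0 : weight xi (basis_fun xi tau 0).
  by have := weight_basis_fun xi tau 0; rewrite mulr0 addr0.
have [g gE] := xbargen_lift w0 (basis_fun_casimir xi tau).
by exists g => j; rewrite chain_linear gE chain_basis_fun.
Qed.

Lemma basis_fun_neq0 j : basis_fun xi tau j <> 0.
Proof.
move/(congr1 (fun phi : model xi tau => phi j)).
rewrite /basis_fun eqxx => one0.
have : (1 : K) = 0 by exact: one0.
by move/eqP; rewrite oner_eq0.
Qed.

(** Functions vanishing at all indices up to [j0] form a submodule: only f lowers indices, and its
    coefficient from j0 + 1 to j0 is [fe_coef] at [j0], which is 0. *)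
Lemma basis_fun_upper u (k : int) : k <= j0 ->
  (u *: basis_fun xi tau (j0%:Z + 1) : model xi tau) k = 0.
Proof.
elim/usl2_ind: u k => [|a u v IHu IHv|i u IH] k kj0.
- rewrite scale1r /basis_fun; case: eqP kj0 => [->|//].
  by rewrite lezD1 ltxx.
- rewrite scalerDl -mulr_algl -scalerA usl2_repmod_scalar.
  transitivity (a * (u *: basis_fun xi tau (j0%:Z + 1) : model xi tau) k +
    (v *: basis_fun xi tau (j0%:Z + 1) : model xi tau) k : K); first by [].
  by rewrite IHu // IHv // mulr0 addr0.
- rewrite -scalerA; case: i; rewrite ?model_e ?model_h ?model_f /=.
  + by rewrite IH ?mulr0 // (le_trans _ kj0) // gerBl.
  + by rewrite IH ?mulr0.
  + have [->|kj] := eqVneq k j0.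
      rewrite /down_coef lezD1 (_ : (Posz j0 < 0) = false) // addrK.
      by rewrite [X in X * _]fe_coef_j0 mul0r.
    by rewrite IH ?mulr0 // lezD1 lt_neqAle kj.
Qed.

(** Below [j0] no coefficient of f vanishes: it is 1 at indices <= 0, and at positive indices it is
    some [coef j] with j < j0. *)
Lemma f_basis_fun_j0 i : exists2 a : K, a != 0 &
  sl2_f K ^+ i *: basis_fun xi tau j0 = (a%:A : U) *: basis_fun xi tau (j0%:Z - i%:Z).
Proof.
elim: i => [|i [a a0 IH]]; first by exists 1; rewrite ?oner_neq0 // expr0 subr0 !scale1r.
exists (a * down_coef xi tau (j0%:Z - i%:Z)); last first.
  rewrite exprS -scalerA IH scale_algC f_basis_fun scale_algM.
  by rewrite -[i.+1]addn1 PoszD opprD addrA.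
rewrite mulf_neq0 // /down_coef; case: ifP => [_|]; first exact: oner_neq0.
move/negbT; rewrite -ltNge subr_gt0 ltz_nat => ij0.
rewrite -addrA -opprD -[_ + 1]PoszD addn1 subzn //.
by rewrite fe_coef_neq0 // ltn_subrL (leq_ltn_trans _ ij0).
Qed.

Definition lowest := ladder (Posz j0.+1).
Local Notation lowest_submod := (cyclic lowest).

(** In the model, elements of Y vanish at indices up to [j0], while f^i v_{j0} is a nonzero multiple
    of the indicator of j0 - i. *)
Lemma f_ladder_notin i : sl2_f K ^+ i *: ladder j0 \notin lowest_submod.
Proof.
apply/negP => /asboolP[u uE]; have [g gE] := to_model.
have guE : sl2_f K ^+ i *: basis_fun xi tau j0 = u *: basis_fun xi tau (j0%:Z + 1).
  by rewrite -[j0%:Z + 1]PoszD addn1 -!gE -!(linearZ_LR g) uE.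
have [a a0 aE] := f_basis_fun_j0 i.
have := basis_fun_upper u (k := j0%:Z - i%:Z); rewrite -guE aE gerBl => /(_ isT).
rewrite usl2_repmod_scalar => a_eq0.
have : a * (j0%:Z - i%:Z == j0%:Z - i%:Z)%:R = 0 :> K by exact: a_eq0.
by rewrite eqxx mulr1 => /eqP; rewrite (negPf a0).
Qed.

Lemma xbar_top_weight : weight (xi + 2%:R * j0%:R) (ladder j0).
Proof. exact: (weight_chain Usl2 (xbargen_weight xi tau) j0). Qed.

Lemma lowest_weight : weight (xi + 2%:R * j0%:R + 2%:R) lowest.
Proof.
rewrite /lowest [ladder _]/= exprS -scalerA.
exact: (weight_e Usl2 xbar_top_weight).
Qed.

Lemma lowest_f : sl2_f K *: lowest = 0.
Proof. by rewrite f_ladderS fe_coef_j0 !scale0r. Qed.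

Lemma tauE : tau = (xi + 2%:R * j0%:R + 1) ^+ 2.
Proof. by apply/eqP; rewrite -subr_eq0 tau_j0. Qed.

(** The highest weight vector goes to the class of v_{j0}, which e kills since v_{j0+1} lies in Y.
    Injectivity comes from [f_ladder_notin], surjectivity from [f_ladder_down]. *)
Lemma quotient_iso : isomorphic (quotmod lowest_submod) (VermaHigh (xi + 2%:R * j0%:R)).
Proof.
apply: isomorphic_sym.
have v_weight := weight_linear (qcl lowest_submod) xbar_top_weight.
have v_e : sl2_e K *: qcl lowest_submod (ladder j0) = 0.
  rewrite -linearZ_LR scalerA -exprS -(qcl0 lowest_submod); apply/qclP.
  by rewrite subr0; exact: cyclic_gen.
have [g gE] := hwgen_lift v_weight v_e.
have h_cas := hwgen_casimir (xi + 2%:R * j0%:R); rewrite -tauE in h_cas.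
apply: (lin_iso (f := g)) => [|q].
  apply: (cyclic_injective_central Usl2 (hwgen_weight _) (@hwgen_cyclic _ _) h_cas).
  have f_neq0 i : sl2_f K ^+ i *: qcl lowest_submod (ladder j0) <> 0.
    rewrite -linearZ_LR -(qcl0 lowest_submod) => /qclP.
    by rewrite subr0 (negPf (f_ladder_notin i)).
  move=> [[|n]|n]; rewrite gE.
  - by right; have := f_neq0 0%N; rewrite /= !expr0.
  (* The positive part of the chain is already 0 in the Verma module. *)
  - by left; rewrite /= exprSr -scalerA hwgen_e scaler0.
  - by right; exact: f_neq0.
have [x ->] := qcl_surj q; have [u ->] := xbargen_cyclic x.
have [a a0 aE] := f_ladder_down (leqnn j0).
exists (u *: ((a^-1%:A : U) *: (sl2_f K ^+ j0 *: hwgen _))).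
by rewrite !(linearZ_LR g) gE -!(linearZ_LR (qcl lowest_submod)) aE scale_algK.
Qed.

(** The lowest weight vector goes to v_{j0+1}. Its images under the powers e^n are the v_{n+j0+1},
    nonzero because the model sends them to indicator functions. *)
Lemma submodule_iso :
  isomorphic (submod_type lowest_submod) (VermaLow (xi + 2%:R * j0%:R + 2%:R)).
Proof.
apply: isomorphic_sym.
pose y : submod_type lowest_submod := Sub lowest (cyclic_gen lowest).
have valZ u : val (u *: y) = u *: lowest by [].
have y_weight : weight (xi + 2%:R * j0%:R + 2%:R) y.
  by apply: val_inj; rewrite /= lowest_weight.
have y_f : sl2_f K *: y = 0 by apply: val_inj; exact: lowest_f.
have [g gE] := lwgen_lift y_weight y_f.
have l_cas := lwgen_casimir (xi + 2%:R * j0%:R + 2%:R).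
(* For delta = xi + 2 j0 + 2, the Casimir scalar (delta - 1)^2 is (xi + 2 j0 + 1)^2 = tau. *)
rewrite (_ : _ ^+ 2 = tau) in l_cas; last first.
  rewrite tauE; congr (_ ^+ 2); rewrite -addrA; congr (_ + _).
  by rewrite -[2%:R]natr1 addrK.
apply: (lin_iso (f := g)) => [|q].
  apply: (cyclic_injective_central Usl2 (lwgen_weight _) (@lwgen_cyclic _ _) l_cas).
  move=> [n|n]; rewrite gE.
    right => yn0; have [h hE] := to_model.
    have en0 : sl2_e K ^+ n *: lowest = 0 := congr1 val yn0.
    apply: (basis_fun_neq0 (j := Posz (n + j0.+1))).
    by rewrite -hE -exp_chain en0 linear0.
  by left; rewrite /= exprSr -scalerA lwgen_f scaler0.
have /asboolP[u uE] := valP q; exists (u *: lwgen _).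
by apply: val_inj; rewrite linearZ_LR gE valZ.
Qed.

End Degenerate.

Theorem theorem2p15 (R : realType) (xi tau : R[i]) :
  [/\ forall x : X xi, x \in cas_img tau 0 (X xi),
      forall k : nat,
        {subset cas_img tau k.+1 (X xi) <= cas_img tau k (X xi)} /\
        isomorphic (subquot (cas_img tau k (X xi)) (cas_img tau k.+1 (X xi)))
                   (Xbar xi tau),
      (forall j : nat, tau - (xi + 2%:R * j%:R + 1) ^+ 2 != 0) ->
        isomorphic (Xbar xi tau) (dense xi tau)
    & forall j0 : nat,
        tau - (xi + 2%:R * j0%:R + 1) ^+ 2 = 0 ->
        (forall j : nat, (j < j0)%N ->
           tau - (xi + 2%:R * j%:R + 1) ^+ 2 != 0) ->
        exists Y : submodClosed (Xbar xi tau),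
          [/\ exists x : Xbar xi tau, x \notin Y,
              isomorphic (quotmod Y) (VermaHigh (xi + 2%:R * j0%:R))
            & isomorphic (submod_type Y)
                (VermaLow (xi + 2%:R * j0%:R + 2%:R))]].
Proof.
split=> [x|k|tau_generic|j0 tau_j0 tau_lt_j0].
- by apply/asboolP; exists x; rewrite expr0 scale1r.
- by split; [exact: cas_img_sub | exact: filtration_subquot].
- exact: Xbar_dense_iso.
- exists (cyclic_submod (@lowest _ xi tau j0)); split.
  (* Properness is witnessed by v_{j0}, the case i = 0 of [f_ladder_notin]. *)
  + exists (sl2_f _ ^+ 0 *: chain (sl2_e _) (sl2_f _) (xbargen xi tau) j0).
    exact: f_ladder_notin.
  + exact: quotient_iso.
  + exact: submodule_iso.
Qed.
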